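(* Let $S$ be a standard graded Koszul $k$-algebra over a field $k$, and let $M$ be a finitely generated graded $S$-module with a minimal graded free resolution $F\to M$. Fix an integer $r>0$. Then $M$ is componentwise linear in the first $r+1$ steps if and only if $H_n(\operatorname{lin}(F))=0$ for $0<n<r$ and the natural map $H_0(\operatorname{lin}(F))\to\operatorname{gr}(M)$ is an isomorphism.
   Context: Let $\mathfrak{m}$ be the maximal graded ideal of $S$. $S$ is Koszul if the $S$-module $k$ has a linear resolution. For a finitely generated graded $S$-module $M$, write $\beta_{i,j}(M)=\dim_k\operatorname{Tor}^S_i(M,k)_j$, and let $M_{\langle d\rangle}=SM_d$ be the submodule generated by the degree $d$ part and $M_{\langle\leqslant d\rangle}=SM_{\leqslant d}$ the submodule generated by elements of degree at most $d$. $M$ satisfies condition $N_{d,p}$ (for $M$ generated in degree $d$: ''linear in the first $p$ steps'') if it is generated in degree $d$ and $\beta_{i,j}(M)=0$ for all $j\neq i+d$ when $i<p$. $M$ is *componentwise linear in the first $p$ steps* if $M_{\langle d\rangle}$ satisfies condition $N_{d,p}$ for all $d$. For a minimal complex $F$ of graded free $S$-modules, let $F_{\langle\leqslant d\rangle}$ be the subcomplex with $(F_{\langle\leqslant d\rangle})_n=(F_n)_{\langle\leqslant d+n\rangle}$, and let $F_{\langle d\rangle}=F_{\langle\leqslant d\rangle}/F_{\langle\leqslant d-1\rangle}$ be the $d$-linear strand. The *linear part* of $F$ is $\operatorname{lin}(F)=\bigoplus_dF_{\langle d\rangle}$; equivalently, $\operatorname{lin}_n(F)=F_n$ with differential obtained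 by deleting all nonlinear entries from homogeneous matrices representing the differential of $F$. $\operatorname{gr}(M)=\bigoplus_dM_{\langle\leqslant d\rangle}/M_{\langle\leqslant d-1\rangle}$, which is the associated graded module of $M$ with respect to its $\mathfrak{m}$-adic filtration. The augmentation $F\to M$ induces augmentations $F_{\langle d\rangle}\to M_{\langle\leqslant d\rangle}/M_{\langle\leqslant d-1\rangle}$, which assemble into the natural map $H_0(\operatorname{lin}(F))\to\operatorname{gr}(M)$. *)

(* Defs.v *)
From mathcomp Require Import all_boot all_order all_algebra.
From mathcomp Require Import boolp classical_sets functions.

Set Implicit Arguments.
Unset Strict Implicit.
Unset Printing Implicit Defensive.

Import Order.TTheory GRing.Theory Num.Theory.
Local Open Scope classical_set_scope.
Local Open Scope ring_scope.

(* [V] is the internal direct sum of the subgroups [D i], [i : I]. *)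
Record is_grading (I : eqType) (V : zmodType) (D : I -> set V) : Prop := {
  grading0 : forall i, D i 0;
  gradingB : forall i x y, D i x -> D i y -> D i (x - y);
  grading_sum : forall x : V, exists (s : seq I) (f : I -> V),
    (forall i, D i (f i)) /\ x = \sum_(i <- s) f i;
  grading_direct : forall (s : seq I) (f : I -> V), uniq s ->
    (forall i, D i (f i)) -> \sum_(i <- s) f i = 0 ->
    forall i, i \in s -> f i = 0 }.

(* Commutative; [sga_deg i] is the degree [i] part, zero for [i < 0]. The last
   axiom says that finitely many elements of degree 1 generate the algebra. *)
Record stdGradedAlg (k : fieldType) := StdGradedAlg {
  sga_sort :> comAlgType k;
  sga_deg : int -> set sga_sort;
  sga_grading : is_grading sga_deg;
  sga_neg : forall i x, i < 0 -> sga_deg i x -> x = 0;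
  sga_deg0 : forall x, sga_deg 0 x <-> exists c : k, x = c%:A;
  sga_mul : forall i j x y,
    sga_deg i x -> sga_deg j y -> sga_deg (i + j) (x * y);
  sga_gen : exists (n : nat) (g : 'I_n -> sga_sort),
    (forall i, sga_deg 1 (g i)) /\
    forall P : {pred sga_sort}, GRing.subalg_closed P ->
      (forall i, g i \in P) -> forall x, x \in P }.

Record grMod (k : fieldType) (S : stdGradedAlg k) := GrMod {
  gm_sort :> lmodType S;
  gm_deg : int -> set gm_sort;
  gm_grading : is_grading gm_deg;
  gm_scale : forall i j (a : S) (v : gm_sort),
    sga_deg i a -> gm_deg j v -> gm_deg (i + j) (a *: v) }.

Definition regMod (k : fieldType) (S : stdGradedAlg k) : grMod S :=
  @GrMod k S S^o (@sga_deg k S) (@sga_grading k S) (@sga_mul k S).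

Section Submodules.
Variables (R : comNzRingType) (V : lmodType R).

Definition span (X : set V) : set V :=
  [set x | exists (n : nat) (a : 'I_n -> R) (v : 'I_n -> V),
     (forall i, X (v i)) /\ x = \sum_(i < n) a i *: v i].

Definition fin_gen : Prop :=
  exists (n : nat) (v : 'I_n -> V), span (range v) = setT.

(* The quotient [num / den], for submodules [den `<=` num] of [V]. *)
Record subquot := SubQuot { num : set V; den : set V }.

Definition sq_sub (N : set V) : subquot := SubQuot N [set 0].

Definition sq_zero (Q : subquot) : Prop := num Q `<=` den Q.

End Submodules.

(* [f] induces an isomorphism from [num Q / den Q] onto [num Q' / den Q']. *)
Definition sq_iso (R : comNzRingType) (V W : lmodType R) (f : V -> W)
    (Q : subquot V) (Q' : subquot W) : Prop :=
  [/\ (forall x, num Q x -> num Q' (f x)),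
      (forall x, den Q x -> den Q' (f x)),
      (forall x, num Q x -> den Q' (f x) -> den Q x) &
      (forall y, num Q' y -> exists2 x, num Q x & den Q' (y - f x))].

(* Homology at position [n] of the complex with terms [Q n] and differential
   induced by [d]; the map out of position 0 is zero. *)
Definition homology (R : comNzRingType) (X : nat -> lmodType R)
    (d : forall n, X n.+1 -> X n) (Q : forall n, subquot (X n)) (n : nat) :
    subquot (X n) :=
  SubQuot
    (match n return set (X n) with
     | 0%N => num (Q 0%N)
     | m.+1 => [set x | num (Q m.+1) x /\ den (Q m) (d m x)]
     end)
    [set x | exists y z, [/\ den (Q n) y, num (Q n.+1) z & x = y + d n z]].

(* [\bigoplus_d Q d], as a subquotient of the functions [int -> V]. *)
Definition dsum (R : comNzRingType) (V : lmodType R) (Q : int -> subquot V) :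
    subquot (int -> V) :=
  let fin_supp (f : int -> V) :=
    exists s : seq int, forall d, d \notin s -> f d = 0 in
  SubQuot [set f | fin_supp f /\ forall d, num (Q d) (f d)]
          [set f | fin_supp f /\ forall d, den (Q d) (f d)].

Section GradedModules.
Variables (k : fieldType) (S : stdGradedAlg k).

Definition max_ideal : set (regMod S) :=
  span [set a | exists2 i : int, 0 < i & gm_deg i a].

Definition max_ideal_mul (V : grMod S) : set V :=
  span [set x | exists a : S, exists v : V, max_ideal a /\ x = a *: v].
Arguments max_ideal_mul : clear implicits.

Definition residue_field : subquot (regMod S) := SubQuot setT max_ideal.

Definition gen_deg (V : grMod S) (d : int) : set V := span (gm_deg d).
Arguments gen_deg : clear implicits.

Definition gen_le (V : grMod S) (d : int) : set V :=
  span [set x | exists2 i : int, i <= d & gm_deg i x].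
Arguments gen_le : clear implicits.

Definition gr (V : grMod S) : subquot (int -> V) :=
  dsum (fun d => SubQuot (gen_le V d) (gen_le V (d - 1))).
Arguments gr : clear implicits.

(* Existence of a homogeneous basis, of any cardinality. *)
Definition graded_free (V : grMod S) : Prop :=
  exists (I : eqType) (e : I -> V),
    [/\ (forall i, exists d, gm_deg d (e i)),
        (forall x, exists (s : seq I) (c : I -> S),
           x = \sum_(i <- s) c i *: e i) &
        (forall (s : seq I) (c : I -> S), uniq s ->
           \sum_(i <- s) c i *: e i = 0 -> forall i, i \in s -> c i = 0)].

Definition deg_preserving (V W : grMod S) (f : V -> W) : Prop :=
  forall d x, gm_deg d x -> gm_deg d (f x).

Record grComplex := GrComplex {
  cx :> nat -> grMod S;
  diff : forall n, {linear cx n.+1 -> cx n};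
  diff_deg : forall n, deg_preserving (diff n);
  diff_diff : forall n x, diff n (diff n.+1 x) = 0 }.

Definition minimal (C : grComplex) : Prop :=
  forall n x, max_ideal_mul (C n) (diff C n x).

(* [C] is a graded free resolution of [num Q / den Q]; the augmentation is
   induced by [eps]. *)
Definition free_resolution (V : grMod S) (Q : subquot V)
    (C : grComplex) (eps : {linear C 0%N -> V}) : Prop :=
  let H := homology (fun n => diff C n) (fun n => sq_sub (@setT (C n))) in
  [/\ (forall n, graded_free (C n)),
      deg_preserving eps,
      (forall n, (0 < n)%N -> sq_zero (H n)) &
      sq_iso eps (H 0%N) Q].

Definition koszul : Prop :=
  exists (C : grComplex) (eps : {linear C 0%N -> regMod S}),
    free_resolution residue_field eps /\
    forall n : nat, gen_deg (C n) n%:Z = setT.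

(* Homology of [C (x)_S k], where [C n (x)_S k = C n / m (C n)]. *)
Definition homology_tensor_k (C : grComplex) (n : nat) : subquot (C n) :=
  homology (fun n => diff C n)
    (fun n => SubQuot (@setT (C n)) (max_ideal_mul (C n))) n.

Definition deg_part (V : grMod S) (Q : subquot V) (j : int) : subquot V :=
  SubQuot (num Q `&` gm_deg j) (den Q `&` gm_deg j).

(* beta_(i,j)(Q) = 0, i.e. Tor_i(Q, k)_j = 0, with Tor computed from a graded
   free resolution of Q. *)
Definition betti_vanishes (V : grMod S) (Q : subquot V) (i : nat) (j : int) :
    Prop :=
  exists (C : grComplex) (eps : {linear C 0%N -> V}),
    free_resolution Q eps /\ sq_zero (deg_part (homology_tensor_k C i) j).

(* Condition N_(d,p) for a graded submodule [N] of [V]. *)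
Definition condN (V : grMod S) (N : set V) (d : int) (p : nat) : Prop :=
  span (N `&` gm_deg d) = N /\
  forall (i : nat) (j : int), (i < p)%N -> j != i%:Z + d ->
    betti_vanishes (sq_sub N) i j.

Definition componentwise_linear (M : grMod S) (p : nat) : Prop :=
  forall d : int, condN (gen_deg M d) d p.

(* The [d]-linear strand of a minimal complex. Minimality is what makes
   [fun n => gen_le (F n) (d + n%:Z)] a subcomplex of [F]. *)
Definition strand (F : grComplex) (d : int) (n : nat) : subquot (F n) :=
  SubQuot (gen_le (F n) (d + n%:Z)) (gen_le (F n) (d - 1 + n%:Z)).

(* The differential of [lin F] acts on each strand as that of [F]. *)
Definition homology_lin (F : grComplex) (n : nat) : subquot (int -> F n) :=
  homology (X := fun n => (int -> F n : lmodType S))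
    (fun n f => diff F n \o f)
    (fun n => dsum (fun d => strand F d n)) n.

(* The natural map H_0(lin F) -> gr M induced by the augmentation [eps]. *)
Definition lin_gr_iso (M : grMod S) (F : grComplex)
    (eps : {linear F 0%N -> M}) : Prop :=
  sq_iso (fun f : int -> F 0%N => eps \o f) (homology_lin F 0%N) (gr M).

End GradedModules.

(* Main.v *)
From HB Require Import structures.
Require Import Defs.
From mathcomp Require Import all_boot all_order all_algebra.
From mathcomp Require Import boolp classical_sets functions.
From mathcomp Require Import zify.

(* Fix a Koszul resolution [C] of [k], and for each [d] let [E d n] say that the
   strand [F_<=d -> M_<=d] is exact at position [n]. The long exact sequences of
   [0 -> F_<=d-1 -> F_<=d -> F_<d> -> 0], with induction on [d] (everything is
   bounded below since [M] is finitely generated), turn the condition on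
   [lin F] into: [E d n] for all [d] and all [n < r].

   By minimality [F_<=d] contains all elements of the kernel [K_n] at position
   [n] of degree at most [d + n + 1] as boundaries, so [E d n] says that [K_n]
   is generated in degrees at most [d + n + 1]; while exactness holds up to [n],
   [K_n] is a syzygy of [M_<=d], so this is the vanishing of
   [Tor_(n+1)(M_<=d, k)_j] for [j > d + n + 1].

   Finally Tor is balanced: [Tor_i(N, k)_j] is the homology of [C (x) N], and
   since [C_i] is generated in degree [i] it only involves [N_(j-i-1)],
   [N_(j-i)] and [N_(j-i+1)]. For [j > i + d] these agree for [M_<=d] and for
   [M_<d>], which is where Koszulness enters. *)

Local Open Scope classical_set_scope.
Local Open Scope ring_scope.

Set Implicit Arguments.
Unset Strict Implicit.
Unset Printing Implicit Defensive.

Import Order.TTheory GRing.Theory Num.Theory.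

Local Notation span := Defs.span.

(** * Finite supports and homogeneous components *)

Definition supp_in (I : eqType) (V : zmodType) (f : I -> V) (s : seq I) :=
  forall i, i \notin s -> f i = 0.

Lemma supp_in_undup (I : eqType) (V : zmodType) (f : I -> V) (s : seq I) :
  supp_in f s -> supp_in f (undup s).
Proof. by move=> h i; rewrite mem_undup => /h. Qed.

Lemma sum_supp (I : eqType) (V : zmodType) (f : I -> V) (s t : seq I) :
    uniq s -> uniq t -> supp_in f s -> supp_in f t ->
  \sum_(i <- s) f i = \sum_(i <- t) f i.
Proof.
move=> us ut hs ht.
rewrite [LHS](bigID (mem t)) [RHS](bigID (mem s)) /=.
rewrite [X in _ + X = _]big1 => [|i /ht //].
rewrite [X in _ = _ + X]big1 => [|i /hs //].
rewrite !addr0.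
rewrite -big_filter -[RHS]big_filter; apply: perm_big.
apply: uniq_perm; rewrite ?filter_uniq // => i.
by rewrite !mem_filter andbC.
Qed.

Lemma int_seq_bound (s : seq int) : exists l : int, forall i, i \in s -> l <= i.
Proof.
elim: s => [|i s [l hl]]; first by exists 0.
by exists (Num.min i l) => j; rewrite inE => /orP[/eqP ->|/hl]; lia.
Qed.

Section Components.
Variables (I : eqType) (V : zmodType) (D : I -> set V) (HD : is_grading D).

Lemma grN i x : D i x -> D i (- x).
Proof. by move=> h; rewrite -[- x]add0r; apply: (gradingB HD) h; apply: (grading0 HD). Qed.

Lemma grD i x y : D i x -> D i y -> D i (x + y).
Proof. by move=> hx hy; rewrite -[y]opprK; apply: (gradingB HD) => //; apply: grN. Qed.

Lemma gr_sum i (J : Type) (r : seq J) (P : pred J) (f : J -> V) :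
  (forall j, P j -> D i (f j)) -> D i (\sum_(j <- r | P j) f j).
Proof. by move=> h; apply: big_ind => //; [apply: (grading0 HD)|apply: grD]. Qed.

Lemma decomp x : exists f : I -> V, (forall i, D i (f i)) /\
  exists2 s, uniq s & supp_in f s /\ x = \sum_(i <- s) f i.
Proof.
have [s [f [hf ->]]] := grading_sum HD x.
(* [grading_sum] allows repeated indices in [s], so [f i] has to be taken as often as [i] occurs
   there. *)
exists (fun i => iterop (count_mem i s) +%R (f i) 0); split.
  by move=> i; rewrite Monoid.iteropE; elim: (count_mem i s) => [|n IH];
    [apply: (grading0 HD)|apply: grD].
exists (undup s); first exact: undup_uniq.
split; last by rewrite (big_undup_iterop_count +%R s xpredT f).
by move=> i; rewrite mem_undup => /count_memPn ->.
Qed.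

Definition hcomp (i : I) (x : V) : V := sval (cid (decomp x)) i.

Lemma compP i x : D i (hcomp i x).
Proof. by rewrite /hcomp; case: cid => f [] /=. Qed.

Lemma comp_sum x : exists2 s, uniq s &
  supp_in (hcomp ^~ x) s /\ x = \sum_(i <- s) hcomp i x.
Proof. by rewrite /hcomp; case: cid => f [] /=. Qed.

(** Over the union of both supports, [grading_direct] kills the difference of the two
    decompositions. The choice made in [hcomp] is therefore harmless, and components are computed by
    exhibiting some decomposition. *)
Lemma comp_uniq (f : I -> V) s x : uniq s -> (forall i, D i (f i)) ->
  supp_in f s -> x = \sum_(i <- s) f i -> forall i, hcomp i x = f i.
Proof.
move=> us hf hs hx i.
have [t ut [ht hxt]] := comp_sum x.
pose u := undup (s ++ t); have uu : uniq u by apply: undup_uniq.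
have su : supp_in f u.
  by move=> j; rewrite mem_undup mem_cat negb_or => /andP[/hs].
have tu : supp_in (hcomp ^~ x) u.
  by move=> j; rewrite mem_undup mem_cat negb_or => /andP[_ /ht].
have hd : \sum_(j <- u) (hcomp j x - f j) = 0.
  rewrite big_split /= sumrN (sum_supp uu ut tu ht) (sum_supp uu us su hs).
  by rewrite -hx -hxt subrr.
have [iu|iu] := boolP (i \in u); last by rewrite (su _ iu) (tu _ iu).
apply/eqP; rewrite -subr_eq0; apply/eqP.
apply: (grading_direct HD uu (f := fun j => hcomp j x - f j) _ hd) => // j.
by apply: (gradingB HD) => //; apply: compP.
Qed.

Lemma comp_additive i : {morph hcomp i : x y / x + y}.
Proof.
move=> x y.
have [s us [hs hx]] := comp_sum x.
have [t ut [ht hy]] := comp_sum y.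
pose u := undup (s ++ t); have uu : uniq u by apply: undup_uniq.
have su : supp_in (hcomp ^~ x) u.
  by move=> j; rewrite mem_undup mem_cat negb_or => /andP[/hs].
have tu : supp_in (hcomp ^~ y) u.
  by move=> j; rewrite mem_undup mem_cat negb_or => /andP[_ /ht].
apply: (comp_uniq (f := fun i => hcomp i x + hcomp i y) uu).
- by move=> j; apply: grD; apply: compP.
- by move=> j ju; rewrite /= su // tu // addr0.
by rewrite big_split /= (sum_supp uu us) // (sum_supp uu ut) // -hx -hy.
Qed.

Lemma comp_hom i j x : D i x -> hcomp j x = if j == i then x else 0.
Proof.
move=> hx; apply: (comp_uniq (f := fun j => if j == i then x else 0) (s := [:: i])) => //.
- by move=> l; case: eqP => [->//|_]; apply: (grading0 HD).
- by move=> l; rewrite inE => /negbTE ->.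
by rewrite big_seq1 eqxx.
Qed.

Lemma comp_id i x : D i x -> hcomp i x = x.
Proof. by move=> /(@comp_hom i i) ->; rewrite eqxx. Qed.

Lemma comp0 i : hcomp i 0 = 0.
Proof. by apply: comp_id; apply: (grading0 HD). Qed.

Lemma compN i : {morph hcomp i : x / - x}.
Proof. by move=> x; apply/eqP; rewrite -addr_eq0 -comp_additive addNr comp0. Qed.

Lemma compB i : {morph hcomp i : x y / x - y}.
Proof. by move=> x y; rewrite comp_additive compN. Qed.

Lemma comp_big i (J : Type) (r : seq J) (P : pred J) (f : J -> V) :
  hcomp i (\sum_(j <- r | P j) f j) = \sum_(j <- r | P j) hcomp i (f j).
Proof. by apply: big_morph; [apply: comp_additive|apply: comp0]. Qed.

End Components.

(** * Submodules as predicates, and spans *)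

Section Submod.
Variables (R : comNzRingType) (V : lmodType R).

Definition submod (N : set V) := N 0 /\ forall a x y, N x -> N y -> N (a *: x + y).

Lemma submod0 N : submod N -> N 0. Proof. by case. Qed.
Lemma submodD N x y : submod N -> N x -> N y -> N (x + y).
Proof. by move=> [_ h] hx hy; rewrite -[x]scale1r; apply: h. Qed.
Lemma submodZ N a x : submod N -> N x -> N (a *: x).
Proof. by move=> [h0 h] hx; rewrite -[_ *: _]addr0; apply: h. Qed.
Lemma submodN N x : submod N -> N x -> N (- x).
Proof. by move=> hN hx; rewrite -scaleN1r; apply: submodZ. Qed.
Lemma submodB N x y : submod N -> N x -> N y -> N (x - y).
Proof. by move=> hN hx hy; apply: submodD => //; apply: submodN. Qed.
Lemma submod_sum N (J : eqType) (r : seq J) (f : J -> V) : submod N ->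
  (forall j, j \in r -> N (f j)) -> N (\sum_(j <- r) f j).
Proof.
move=> hN h; rewrite big_seq; apply: (big_ind N) => //; first exact: submod0.
by move=> x y; apply: submodD.
Qed.

Lemma submodT : submod setT. Proof. by []. Qed.
Lemma submod_set0 : submod [set 0].
Proof. by split => // a x y /= -> ->; rewrite scaler0 addr0. Qed.
Lemma submodI N K : submod N -> submod K -> submod (N `&` K).
Proof.
move=> [n0 hN] [k0 hK]; split=> // a x y [? ?] [? ?].
by split; [apply: hN|apply: hK].
Qed.

Lemma span_sub (X N : set V) : submod N -> X `<=` N -> span X `<=` N.
Proof.
move=> hN h _ [n [a [v [hv ->]]]]; apply: submod_sum => // i _.
by apply: submodZ => //; apply: h.
Qed.

Lemma span_gen (X : set V) : X `<=` span X.
Proof.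
by move=> x hx; exists 1%N, (fun=> 1), (fun=> x); split => //; rewrite big_ord1 scale1r.
Qed.

Lemma span_submod (X : set V) : submod (span X).
Proof.
split; first by exists 0%N, (fun=> 0), (fun=> 0); split => [[]//|]; rewrite big_ord0.
move=> c _ _ [n [a [v [hv ->]]]] [m [b [w [hw ->]]]].
exists (n + m)%N, (fun i => match fintype.split i with inl i => c * a i | inr i => b i end),
  (fun i => match fintype.split i with inl i => v i | inr i => w i end); split.
  by move=> i; case: splitP.
rewrite big_split_ord /= scaler_sumr; congr (_ + _); apply: eq_bigr => i _.
  by have -> : fintype.split (lshift m i) = inl i := unsplitK (inl i); rewrite scalerA.
by have -> : fintype.split (rshift n i) = inr i := unsplitK (inr i).
Qed.

Lemma span_mono (X Y : set V) : X `<=` Y -> span X `<=` span Y.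
Proof.
by move=> h; apply: span_sub => [|x /h]; [apply: span_submod|apply: span_gen].
Qed.

End Submod.
#[global] Hint Resolve submodT submod_set0 : core.
#[global] Hint Extern 0 (submod _) => exact: span_submod : core.

Lemma submod_preim (R : comNzRingType) (V W : lmodType R) (f : {linear V -> W}) N :
  submod N -> submod (f @^-1` N).
Proof.
move=> hN; split => [|a x y /= hx hy]; rewrite /= ?linear0 ?linearP; first exact: submod0.
by apply: (proj2 hN).
Qed.

Lemma submod_im (R : comNzRingType) (V W : lmodType R) (f : {linear V -> W}) N :
  submod N -> submod (f @` N).
Proof.
move=> hN; split; first by exists 0; rewrite ?linear0 //; apply: submod0.
move=> a _ _ [x hx <-] [y hy <-]; exists (a *: x + y); rewrite ?linearP //.
exact: (proj2 hN).
Qed.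

(** * Graded modules *)

Section GradedAlgebra.
Variables (k : fieldType) (S : stdGradedAlg k).
Implicit Types (V W : grMod S) (a b : S) (i j d : int).

Definition scomp i a : S := hcomp (sga_grading S) i a.
Definition mcomp V i (x : V) : V := hcomp (gm_grading V) i x.

Lemma scompP i a : sga_deg i (scomp i a). Proof. exact: compP. Qed.
Lemma mcompP V i (x : V) : gm_deg i (mcomp i x). Proof. exact: compP. Qed.
Lemma mcomp_id V i (x : V) : gm_deg i x -> mcomp i x = x.
Proof. exact: comp_id. Qed.
Lemma mcompD V i : {morph @mcomp V i : x y / x + y}.
Proof. exact: comp_additive. Qed.
Lemma mcompB V i : {morph @mcomp V i : x y / x - y}.
Proof. exact: compB. Qed.
Lemma mcomp0 V i : mcomp i (0 : V) = 0. Proof. exact: comp0. Qed.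
Lemma mcomp_big V i (J : Type) (r : seq J) (P : pred J) (f : J -> V) :
  mcomp i (\sum_(l <- r | P l) f l) = \sum_(l <- r | P l) mcomp i (f l).
Proof. exact: comp_big. Qed.
Lemma mcomp_sum V (x : V) : exists s : seq int, x = \sum_(i <- s) mcomp i x.
Proof. by have [s _ [_ h]] := comp_sum (gm_grading V) x; exists s. Qed.
Lemma scomp_neg i a : i < 0 -> scomp i a = 0.
Proof. by move=> hi; apply: (sga_neg hi); apply: scompP. Qed.

Lemma sga_deg1 : sga_deg 0 (1 : S).
Proof. by apply/sga_deg0; exists 1; rewrite scale1r. Qed.

Lemma mcomp_scale V i j a (v : V) :
  sga_deg i a -> mcomp j (a *: v) = a *: mcomp (j - i) v.
Proof.
move=> ha; have [s us [hs hv]] := comp_sum (gm_grading V) v.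
apply: (comp_uniq (gm_grading V) (f := fun j => a *: mcomp (j - i) v)
  (s := [seq l + i | l <- s])).
- by rewrite map_inj_uniq //; apply: addIr.
- move=> l; rewrite -{1}(subrK i l) addrC; apply: gm_scale => //; exact: mcompP.
- move=> l hl; rewrite [mcomp _ _]hs ?scaler0 //; apply: contra hl => hl.
  by apply/mapP; exists (l - i) => //; rewrite subrK.
by rewrite big_map {1}hv scaler_sumr; apply: eq_bigr => l _; rewrite addrK.
Qed.

Lemma gm_deg_uniq V i j (v : V) : gm_deg i v -> gm_deg j v -> v != 0 -> i = j.
Proof.
move=> hi hj; apply: contra_neq_eq => ij.
by rewrite -(mcomp_id hi) /mcomp (comp_hom _ _ hj) (negbTE ij).
Qed.

Lemma scomp_mul i j a b : sga_deg i a -> scomp j (a * b) = a * scomp (j - i) b.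
Proof. exact: (@mcomp_scale (regMod S)). Qed.

Lemma mcomp_scaler V i j a (v : V) :
  gm_deg i v -> mcomp j (a *: v) = scomp (j - i) a *: v.
Proof.
move=> hv; have [s us [hs ha]] := comp_sum (sga_grading S) a.
apply: (comp_uniq (gm_grading V) (f := fun j => scomp (j - i) a *: v)
  (s := [seq l + i | l <- s])).
- by rewrite map_inj_uniq //; apply: addIr.
- move=> l; rewrite -{1}(subrK i l); apply: gm_scale => //; exact: scompP.
- move=> l hl; rewrite [scomp _ _]hs ?scale0r //; apply: contra hl => hl.
  by apply/mapP; exists (l - i) => //; rewrite subrK.
by rewrite big_map {1}ha scaler_suml; apply: eq_bigr => l _; rewrite addrK.
Qed.

Lemma mcomp_lin V W (f : {linear V -> W}) : deg_preserving f ->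
  forall j x, mcomp j (f x) = f (mcomp j x).
Proof.
move=> hf j x; have [s us [hs hx]] := comp_sum (gm_grading V) x.
apply: (comp_uniq (gm_grading W) (f := fun j => f (mcomp j x)) us).
- by move=> i; apply: hf; apply: mcompP.
- by move=> i /hs; rewrite /mcomp => ->; rewrite linear0.
by rewrite {1}hx linear_sum.
Qed.

Definition homog V (N : set V) := forall x j, N x -> N (mcomp j x).

Lemma homogT V : homog (@setT V). Proof. by []. Qed.

Lemma homogI V (N K : set V) : homog N -> homog K -> homog (N `&` K).
Proof. by move=> hN hK x j [? ?]; split; [apply: hN|apply: hK]. Qed.

Lemma homog_preim V W (f : {linear V -> W}) (N : set W) : deg_preserving f ->
  homog N -> homog (f @^-1` N).
Proof. by move=> hf hN x j /(hN _ j) /=; rewrite (mcomp_lin hf). Qed.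

Lemma homog_set0 V : homog [set (0 : V)].
Proof. by move=> x j /= ->; rewrite mcomp0. Qed.

(** Taking the degree [j] component of a combination of homogeneous generators replaces each
    coefficient by its component of complementary degree, so only such terms need testing against
    [T]. *)
Lemma span_deg V (X T : set V) j x : (forall v, X v -> exists i, gm_deg i v) ->
  submod T -> (forall v i a, X v -> gm_deg i v -> sga_deg (j - i) a -> T (a *: v)) ->
  span X x -> T (mcomp j x).
Proof.
move=> hX hT h [n [a [v [hv ->]]]]; rewrite mcomp_big; apply: submod_sum => // t _.
have [i hi] := hX _ (hv t); rewrite (mcomp_scaler _ _ hi).
by apply: (h _ i) => //; apply: scompP.
Qed.

Lemma homog_span V (X : set V) :
  (forall v, X v -> exists i, gm_deg i v) -> homog (span X).
Proof.
move=> hX x j; apply: span_deg => // v i a hv _ _.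
by apply: submodZ => //; apply: span_gen.
Qed.

(** The product m N inside [V]. Unlike [max_ideal_mul] it applies to submodules, which the
    Nakayama-type arguments need for kernels; homogeneous scalars keep degrees under control. *)
Definition mmul V (N : set V) : set V :=
  span [set x | exists i a v, [/\ 0 < i, sga_deg i a, N v & x = a *: v]].

Lemma mmul_gen V (N : set V) i a v : 0 < i -> sga_deg i a -> N v -> mmul N (a *: v).
Proof. by move=> hi ha hv; apply: span_gen; exists i, a, v. Qed.

(** The scalars in m N have only components of positive degree, so the degree [j] part involves only
    elements of [N] of degree below [j]. *)
Lemma mmul_deg V (N T : set V) j x : homog N -> submod T ->
  (forall v i, i < j -> N v -> gm_deg i v -> T v) -> mmul N x -> T (mcomp j x).
Proof.
move=> hN hT h [n [c [v [hv ->]]]]; rewrite mcomp_big; apply: submod_sum => // t _.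
have [i [a [w [hi ha hw ->]]]] := hv t; have [s ->] := mcomp_sum w.
rewrite !scaler_sumr mcomp_big; apply: submod_sum => // l _.
rewrite scalerA (mcomp_scaler _ _ (mcompP l w)) mulrC (scomp_mul _ _ ha).
have [lj|lj] := ltP l j.
  by apply: submodZ => //; apply: (h _ l) => //; [apply: hN|apply: mcompP].
by rewrite scomp_neg ?mulr0 ?scale0r; [apply: submod0|lia].
Qed.

Lemma max_ideal_mulE V : @max_ideal_mul k S V = mmul setT.
Proof.
apply/seteqP; split; apply: span_sub => //.
  move=> _ [a [v [[n [c [b [hb ->]]]] ->]]]; rewrite scaler_suml.
  apply: submod_sum => // t _; have [i hi hbt] := hb t.
  by rewrite [_ *: b t]mulrC -scalerA; apply: mmul_gen hi hbt _.
move=> _ [i [a [v [hi ha _ ->]]]]; apply: span_gen; exists a, v; split => //.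
by apply: span_gen; exists i.
Qed.

Lemma gen_le_hom V d : homog (@gen_le k S V d).
Proof. by apply: homog_span => v [i _ hi]; exists i. Qed.

Lemma gen_le_submod V d : submod (@gen_le k S V d). Proof. exact: span_submod. Qed.

Lemma gen_le_gen V d i (x : V) : i <= d -> gm_deg i x -> @gen_le k S V d x.
Proof. by move=> hi hx; apply: span_gen; exists i. Qed.

Lemma gen_le_mono V d d' : d <= d' -> @gen_le k S V d `<=` @gen_le k S V d'.
Proof.
by move=> h; apply: span_mono => x [i hi hx]; exists i => //; apply: le_trans h.
Qed.

Lemma gen_le_sub V d (N : set V) : submod N ->
  (forall i x, i <= d -> gm_deg i x -> N x) -> @gen_le k S V d `<=` N.
Proof. by move=> hN h; apply: span_sub => // x [i hi]; apply: h. Qed.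

(** The generators have degree at most [d < i], so every coefficient that contributes in degree [i]
    has positive degree. *)
Lemma gen_le_above V d i (x : V) : d < i -> gm_deg i x -> @gen_le k S V d x ->
  mmul (@gen_le k S V d) x.
Proof.
move=> di hx hd; rewrite -(mcomp_id hx); apply: (span_deg _ _ _ hd) => //.
  by move=> v [l _ hl]; exists l.
move=> v l a [l' hl' hv'] hl ha.
have [->|v0] := eqVneq v 0; first by rewrite scaler0; apply: submod0; apply: span_submod.
have ll' := gm_deg_uniq hl hv' v0.
by apply: mmul_gen ha _; [lia|apply: gen_le_gen hv'].
Qed.

(** Converts minimality into strands: the differential of an element of degree [i] lies in the
    submodule generated in degrees at most [i - 1]. *)
Lemma mmul_gen_le V i (x : V) : gm_deg i x -> mmul setT x -> @gen_le k S V (i - 1) x.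
Proof.
move=> hx hm; rewrite -(mcomp_id hx); apply: mmul_deg hm => //.
by move=> v l li _ hl; apply: gen_le_gen hl; lia.
Qed.

Lemma lin_gen_le V W (f : {linear V -> W}) d x : deg_preserving f ->
  @gen_le k S V d x -> @gen_le k S W d (f x).
Proof.
move=> hf; apply: (gen_le_sub (submod_preim f (gen_le_submod W d))) => i y hi hy.
by apply: gen_le_gen (hf _ _ hy).
Qed.

Lemma lin_mmul V W (f : {linear V -> W}) (N : set V) (K : set W) x :
  (forall y, N y -> K (f y)) -> mmul N x -> mmul K (f x).
Proof.
move=> h; apply: (span_sub (submod_preim f (span_submod _))) => _ [i [a [v [hi ha hv ->]]]].
by rewrite /= linearZ; apply: mmul_gen hi ha (h _ hv).
Qed.

Lemma mmul_lift V W (f : {linear V -> W}) (N : set V) x :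
  mmul (f @` N) x -> exists2 y, mmul N y & f y = x.
Proof.
have hs : submod (f @` mmul N) by apply: submod_im; apply: span_submod.
apply: (span_sub hs) => _ [i [a [_ [hi ha [v hv <-]] ->]]].
by exists (a *: v); [apply: mmul_gen hi ha hv|rewrite linearZ].
Qed.

(** Here generation in degree 1 enters: the elements whose components all satisfy the claim form a
    subalgebra containing the degree 1 generators. *)
Lemma sga_span (t n : int) a : 0 <= t <= n -> sga_deg n a ->
  span (@gm_deg _ _ (regMod S) t) (a : regMod S).
Proof.
pose X t := span (@gm_deg _ _ (regMod S) t).
have XM t1 t2 (x y : regMod S) : X t1 x -> X t2 y -> X (t1 + t2) ((x : S) * (y : S)).
  move=> [p [c [v [hv ->]]]] [q [c' [v' [hv' ->]]]].
  rewrite mulr_suml; apply: (@submod_sum S (regMod S)) => //.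
  move=> l _; rewrite mulr_sumr; apply: (@submod_sum S (regMod S)) => //.
  move=> l' _; have -> : (c l *: v l : S) * (c' l' *: v' l' : S) =
    (c l * c' l') * ((v l : S) * (v' l' : S)) by rewrite mulrACA.
  apply: (@submodZ S (regMod S)) => //.
  apply: (@span_gen S (regMod S)).
  exact: (sga_mul (hv l) (hv' l')).
(* Stated on components, since [sga_gen] needs a predicate on all elements, not just homogeneous
   ones. *)
pose P : {pred S} := fun x => `[< forall n t, 0 <= t <= n -> X t (scomp n x) >].
have hP : GRing.subalg_closed P.
  split.
  - apply/asboolP => m u hmu; rewrite /scomp (comp_hom _ _ sga_deg1).
    case: eqP => [m0|_]; last by apply: (@submod0 S (regMod S)).
    have -> : u = 0 by lia.
    by apply: (@span_gen S (regMod S)); apply: sga_deg1.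
  - move=> c x y /asboolP hx /asboolP hy; apply/asboolP => m u hmu.
    rewrite /scomp (comp_additive (sga_grading S)) -/(scomp m y) -/(scomp m (c *: x)).
    rewrite -[c *: x]mulr_algl (@scomp_mul 0); last by apply/sga_deg0; exists c.
    rewrite subr0; apply: (proj2 (@span_submod S (regMod S) _)); [exact: hx|exact: hy].
  move=> x y /asboolP hx /asboolP hy; apply/asboolP => m u hmu.
  have [s us [_ hs]] := comp_sum (sga_grading S) x.
  rewrite {1}hs mulr_suml /scomp (comp_big (sga_grading S)).
  apply: (@submod_sum S (regMod S)) => // l _.
  rewrite -/(scomp m _) (@scomp_mul l); last exact: compP.
  have [l0|l0] := ltP l 0.
    by rewrite -/(scomp l x) scomp_neg // mul0r; apply: (@submod0 S (regMod S)).
  have [ml|ml] := ltP m l.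
    by rewrite (@scomp_neg (m - l)) ?mulr0; [apply: (@submod0 S (regMod S))|lia].
  (* The degree [u] is split between the two factors, of degrees [l] and [m - l]: the first takes as
     much as it can. *)
  pose t1 := Num.min u l.
  have -> : u = t1 + (u - t1) by lia.
  by apply: XM; [apply: hx|apply: hy]; rewrite /t1; lia.
move=> htn ha.
have [p [g [hg hgen]]] := sga_gen S.
have : a \in P.
  apply: hgen => // l; apply/asboolP => m u hmu.
  rewrite /scomp (comp_hom _ _ (hg l)).
  case: eqP => [m1|_]; last by apply: (@submod0 S (regMod S)).
  have [->|u0] := eqVneq u 1; first by apply: (@span_gen S (regMod S)); apply: hg.
  rewrite -[g l]mulr1; apply: (@submodZ S (regMod S)) => //.
  have -> : u = 0 by lia.
  by apply: (@span_gen S (regMod S)); apply: sga_deg1.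
by move=> /asboolP /(_ _ _ htn); rewrite [scomp _ _]comp_id.
Qed.

(** A coefficient of degree [i - l] lies in the ideal generated by degree [d - l] by [sga_span], and
    multiplying a generator of degree [l] by the latter lands in degree [d]. *)
Lemma gen_le_gen_deg V d i (x : V) :
  d <= i -> gm_deg i x -> @gen_le k S V d x -> @gen_deg k S V d x.
Proof.
move=> di hx hd; rewrite -(mcomp_id hx); apply: (span_deg _ _ _ hd) => //.
  by move=> v [l _ hl]; exists l.
move=> v l a [l' hl' hv'] hl ha.
have [->|v0] := eqVneq v 0; first by rewrite scaler0; apply: submod0; apply: span_submod.
have ll' := gm_deg_uniq hl hv' v0.
have [|n [c [b [hb ->]]]] := @sga_span (d - l) (i - l) a _ ha; first lia.
rewrite scaler_suml; apply: submod_sum => //.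
move=> t _; rewrite -scalerA; apply: submodZ => //.
apply: span_gen; have := gm_scale (hb t) hl; rewrite subrK; exact.
Qed.

Lemma gen_deg_low V d i (v : V) : i < d -> gm_deg i v -> @gen_deg k S V d v -> v = 0.
Proof.
move=> hi hv hd; rewrite -(mcomp_id hv).
apply: (span_deg (T := [set 0])) hd => // [w hw|w j a hw hj ha]; first by exists d.
have [->|w0] := eqVneq w 0; first by rewrite /= scaler0.
by rewrite /= (sga_neg _ ha) ?scale0r // (gm_deg_uniq hj hw w0); lia.
Qed.

Lemma gen_deg_sub_le V d : @gen_deg k S V d `<=` @gen_le k S V d.
Proof. by apply: span_mono => x hx; exists d. Qed.

End GradedAlgebra.
#[global] Hint Resolve gen_le_hom homogT homog_set0 : core.

Definition mk_linear (R : comNzRingType) (U V : lmodType R) (f : U -> V)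
    (hf : linear f) : {linear U -> V} :=
  HB.pack f (GRing.isLinear.Build R U V *:%R f hf).

(** * Free modules and tensors *)

Section FreeModules.
Variables (k : fieldType) (S : stdGradedAlg k).
Implicit Types (P V W : grMod S).

(** A homogeneous basis together with its dual coordinate functionals, on which tensors are tested
    later. *)
Record basis P := Basis {
  bI : eqType;
  be : bI -> P;
  bd : bI -> int;
  bco : bI -> {linear P -> regMod S};
  be_deg : forall b, gm_deg (bd b) (be b);
  bco_sum : forall x, exists2 s, uniq s &
    supp_in (fun b => bco b x : S) s /\ x = \sum_(b <- s) (bco b x : S) *: be b;
  bco_be : forall b b', bco b (be b') = if b == b' then 1 else 0 :> S }.

(** The submodules spanned by single basis elements form an [is_grading] indexed by the basis, so
    [hcomp] and its uniqueness provide the coordinates. *)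
Lemma graded_free_basis P : graded_free P -> inhabited (basis P).
Proof.
move=> [I [e [hdeg hgen hind]]].
pose D i := [set x | exists c : S, x = c *: e i].
have HD : is_grading D.
  split.
  - by move=> i; exists 0; rewrite scale0r.
  - by move=> i _ _ [c ->] [c' ->]; exists (c - c'); rewrite scalerBl.
  - move=> x; have [s [c ->]] := hgen x; exists s, (fun i => c i *: e i).
    by split=> // i; exists (c i).
  - move=> s f us hf hs i hi; have [c hc] := choice hf.
    rewrite hc (hind s c us _ i hi) ?scale0r // -[RHS]hs.
    by apply: eq_bigr => j _; rewrite hc.
have e_inj i (a b : S) : a *: e i = b *: e i -> a = b.
  move=> h; apply/eqP; rewrite -subr_eq0; apply/eqP.
  apply: (hind [:: i] (fun=> a - b)) => //; last exact: mem_head.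
  by rewrite big_seq1 scalerBl h subrr.
have hcZ i (a : S) x : hcomp HD i (a *: x) = a *: hcomp HD i x.
  have [s us [hs hx]] := comp_sum HD x.
  apply: (comp_uniq HD (f := fun i => a *: hcomp HD i x) us).
  - by move=> j; have [c ->] := compP HD j x; exists (a * c); rewrite scalerA.
  - by move=> j /hs ->; rewrite scaler0.
  by rewrite {1}hx scaler_sumr.
pose co i x : regMod S := sval (cid (compP HD i x)).
have coE i x : hcomp HD i x = (co i x : S) *: e i by rewrite /co; case: cid.
have colin i : linear (co i).
  move=> a x y; apply: (e_inj i); rewrite -coE comp_additive hcZ !coE scalerA -scalerDl.
  by [].
have [dl hdl] := choice hdeg.
constructor; apply: (@Basis P I e dl (fun i => mk_linear (colin i))) => //.
- move=> x; have [s us [hs hx]] := comp_sum HD x; exists s => //; split.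
    by move=> i /hs /=; rewrite coE -[X in _ = X](scale0r (e i)) => /e_inj.
  by rewrite {1}hx; apply: eq_bigr => i _; rewrite coE.
move=> i j /=; apply: (e_inj i); rewrite -coE.
rewrite (comp_hom HD (i := j)); last by exists 1; rewrite scale1r.
by case: eqP => [->|]; rewrite ?scale1r ?scale0r.
Qed.

Section Coordinates.
Variables (P : grMod S) (B : basis P).

Lemma bco_uniq (s : seq (bI B)) (c : bI B -> S) x : uniq s ->
  x = \sum_(b <- s) c b *: be b -> forall b, b \in s -> bco b x = c b :> S.
Proof.
move=> us -> b hb; rewrite linear_sum (bigD1_seq b) //= big1 => [|b' hb'].
  by rewrite linearZ /= bco_be eqxx addr0; apply: mulr1.
by rewrite linearZ /= bco_be eq_sym (negbTE hb') scaler0.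
Qed.

Lemma bco_deg (b : bI B) j x : gm_deg j x -> sga_deg (j - bd b) (bco b x : S).
Proof.
move=> hx; have [s us [hs hxs]] := bco_sum B x.
have hx' : x = \sum_(b <- s) scomp (j - bd b) (bco b x : S) *: be b.
  rewrite -{1}(mcomp_id hx) {1}hxs mcomp_big; apply: eq_bigr => b' _.
  by rewrite (mcomp_scaler _ _ (be_deg b')).
have [hb|/hs ->] := boolP (b \in s); last exact: (grading0 (sga_grading S)).
by rewrite (bco_uniq us hx' hb); apply: scompP.
Qed.

Lemma bco_sum_seq (xs : seq P) : exists2 s : seq (bI B), uniq s &
  forall x, x \in xs -> x = \sum_(b <- s) (bco b x : S) *: be b.
Proof.
elim: xs => [|x xs [s us hs]]; first by exists [::].
pose t := undup (s ++ flatten [seq sval (cid2 (bco_sum B y)) | y <- x :: xs]).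
exists t; first exact: undup_uniq.
move=> y hy.
have [u uu [hu hyu]] := bco_sum B y.
pose v := sval (cid2 (bco_sum B y)).
have [uv [hv hyv]] : uniq v /\ supp_in (fun b => bco b y : S) v /\
   y = \sum_(b <- v) (bco b y : S) *: be b by rewrite /v; case: cid2.
rewrite {1}hyv; apply: sum_supp => //; first exact: undup_uniq.
- by move=> b /hv ->; rewrite scale0r.
move=> b; rewrite mem_undup mem_cat negb_or => /andP[_ hb].
rewrite [bco b y](_ : _ = 0) ?scale0r //; apply: hv.
apply: contra hb => hb; apply/flattenP; exists v => //.
by apply/mapP; exists y.
Qed.

End Coordinates.

Lemma functionalZ P (f : {linear P -> regMod S}) (a : S) c : f (a *: c) = a * f c :> S.
Proof. by rewrite linearZ. Qed.

Lemma functional_ker P (f : {linear P -> regMod S}) : submod [set c | f c = 0].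
Proof. exact: (submod_preim f (@submod_set0 S (regMod S))). Qed.

(** A list stands for the sum of the tensors [c (x) v], and [pairing f] is its image under
    [f (x) id] in [S (x) V = V]. No tensor product is constructed; equality of all pairings serves
    as equality of tensors. *)
Definition pairing P V (f : P -> S) (x : seq (P * V)) : V :=
  \sum_(p <- x) f p.1 *: p.2.

(** Functionals homogeneous of degree [- m], such as the coordinates at basis elements of degree
    [m]. *)
Definition hfun P (m : int) (f : {linear P -> regMod S}) : Prop :=
  forall i c, gm_deg i c -> gm_deg (i - m) (f c).

(* [x], read as [\sum c (x) v], is a representative of an element of
   [P_m (x)_k N_e]. *)
Definition tens P V m (N : set V) e (x : seq (P * V)) : Prop :=
  forall p, p \in x -> [/\ gm_deg m p.1, N p.2 & gm_deg e p.2].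

Definition oppx P V (x : seq (P * V)) : seq (P * V) := [seq (- p.1, p.2) | p <- x].

Lemma pairing_nil P V (f : P -> S) : pairing f ([::] : seq (P * V)) = 0.
Proof. by rewrite /pairing big_nil. Qed.

Lemma pairing_cat P V (f : P -> S) (x y : seq (P * V)) :
  pairing f (x ++ y) = pairing f x + pairing f y.
Proof. by rewrite /pairing big_cat. Qed.

Lemma pairing_seq1 P V (f : P -> S) (c : P) (v : V) : pairing f [:: (c, v)] = f c *: v.
Proof. by rewrite /pairing big_seq1. Qed.

Lemma pairing_opp P V (f : {linear P -> regMod S}) (x : seq (P * V)) :
  pairing f (oppx x) = - pairing f x.
Proof.
rewrite /pairing /oppx big_map -sumrN; apply: eq_bigr => p _ /=.
by rewrite linearN; apply: scaleNr.
Qed.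

Lemma pairing_map P V W (f : P -> S) (g : {linear V -> W}) (x : seq (P * V)) :
  pairing f [seq (p.1, g p.2) | p <- x] = g (pairing f x).
Proof.
by rewrite /pairing big_map linear_sum; apply: eq_bigr => p _; rewrite linearZ.
Qed.

Lemma tens_cat P V m (N : set V) e (x y : seq (P * V)) :
  tens m N e x -> tens m N e y -> tens m N e (x ++ y).
Proof. by move=> hx hy p; rewrite mem_cat => /orP[/hx|/hy]. Qed.

Lemma tens_opp P V m (N : set V) e (x : seq (P * V)) :
  tens m N e x -> tens m N e (oppx x).
Proof.
move=> hx _ /mapP[p /hx [h1 h2 h3] ->]; split => //=.
exact: (grN (gm_grading P)).
Qed.

Lemma tens_sub P V m (N K : set V) e (x : seq (P * V)) :
  N `<=` K -> tens m N e x -> tens m K e x.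
Proof. by move=> h hx p /hx [? /h]. Qed.

Lemma tens_map P V W m (g : {linear V -> W}) (N : set V) (K : set W) e (x : seq (P * V)) :
  deg_preserving g -> (forall v, N v -> K (g v)) ->
  tens m N e x -> tens m K e [seq (p.1, g p.2) | p <- x].
Proof.
by move=> hg h hx _ /mapP[p /hx [h1 /h h2 /hg h3] ->].
Qed.

Lemma tens_lift P V W m (g : {linear V -> W}) (N : set V) e (y : seq (P * W)) :
  deg_preserving g -> homog N -> tens m (g @` N) e y ->
  exists2 x, tens m N e x & y = [seq (p.1, g p.2) | p <- x].
Proof.
move=> hg hN; elim: y => [|[c w] y IH] hy; first by exists [::].
have [|x hx ->] := IH; first by move=> p hp; apply: hy; rewrite inE hp orbT.
have [/= hc [v hv hw] hwe] := hy _ (mem_head _ _).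
exists ((c, mcomp e v) :: x).
  move=> p; rewrite inE => /orP[/eqP ->|/hx//]; split => //=; first exact: hN.
  exact: mcompP.
by rewrite /= -(mcomp_lin hg) hw (mcomp_id hwe).
Qed.

Lemma tens_mem P V m (N : set V) e (x : seq (P * V)) (f : P -> S) : submod N ->
  tens m N e x -> N (pairing f x).
Proof. by move=> hN hx; apply: submod_sum => // p /hx [_ h _]; apply: submodZ. Qed.

Lemma tens_deg P V m (N : set V) e (x : seq (P * V)) j (f : {linear P -> regMod S}) :
  hfun j f -> tens m N e x -> gm_deg (m - j + e) (pairing f x).
Proof.
move=> hf hx; rewrite /pairing big_seq; apply: (gr_sum (gm_grading V)).
by move=> p /hx [h1 _ h2]; apply: gm_scale => //; apply: hf.
Qed.

End FreeModules.

(** * Tor computed from the Koszul resolution *)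

Section KoszulHomology.
Variables (k : fieldType) (S : stdGradedAlg k) (C : grComplex S).
Variables (aug : {linear C 0%N -> regMod S}).
Hypothesis hC : free_resolution (residue_field S) aug.
Hypothesis hgen : forall n : nat, @gen_deg k S (C n) n%:Z = setT.
Implicit Types (V W P : grMod S) (n : nat) (i j e : int).

Local Notation d := (diff C).

Lemma kos_low n i (c : C n) : i < n%:Z -> gm_deg i c -> c = 0.
Proof.
by move=> hi hc; apply: (gen_deg_low hi hc); rewrite hgen.
Qed.

Definition kbasis n : basis (C n) :=
  inhabited_witness (graded_free_basis (let: And4 h _ _ _ := hC in h n)).

(** Below degree [n] there are no nonzero elements. If [be b] had larger degree, its coordinate
    would vanish on the generators of degree [n], hence everywhere, although it is 1 at [be b]. *)
Lemma kbasis_deg n (b : bI (kbasis n)) : bd b = n%:Z.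
Proof.
have hb : bco b (be b) = 1 :> S by rewrite bco_be eqxx.
have b0 : be b != 0 by apply/eqP => b0; move/eqP: hb; rewrite b0 linear0 eq_sym oner_eq0.
have [lt|gt|//] := ltgtP (bd b) n%:Z.
  by move: b0; rewrite (kos_low lt (be_deg b)) eqxx.
have : gen_deg n%:Z (be b) by rewrite hgen.
move=> /(span_sub (functional_ker (bco b))) /= h; move: hb; rewrite h => [|v hv].
  by move/esym/eqP; rewrite oner_eq0.
by apply: (@sga_neg _ _ (n%:Z - bd b)); [lia|apply: bco_deg].
Qed.

Lemma hfun_bco n (b : bI (kbasis n)) : hfun n%:Z (bco b).
Proof. by move=> i c hc; rewrite -(kbasis_deg b); apply: bco_deg. Qed.

(** Expanding the left entries in the basis shows that a tensor is determined by finitely many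
    coordinate pairings, with one [s] for all [f]. *)
Lemma pairing_dual n V (x : seq (C n * V)) : exists s : seq (bI (kbasis n)),
  forall f : {linear C n -> regMod S},
  pairing f x = \sum_(b <- s) (f (be b) : S) *: pairing (bco b) x.
Proof.
have [s us hs] := bco_sum_seq (kbasis n) [seq p.1 | p <- x].
exists s => f; rewrite /pairing; under [RHS]eq_bigr do rewrite scaler_sumr.
rewrite exchange_big /= big_seq [RHS]big_seq; apply: eq_bigr => p hp.
rewrite {1}(hs p.1); last by apply/mapP; exists p.
rewrite linear_sum scaler_suml; apply: eq_bigr => b _.
by rewrite linearZ /= scalerA mulrC.
Qed.

Lemma pairing_ext n V (x y : seq (C n * V)) :
  (forall f, hfun n%:Z f -> pairing f x = pairing f y) ->
  forall f : {linear C n -> regMod S}, pairing f x = pairing f y.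
Proof.
move=> h f; apply/eqP; rewrite -subr_eq0 -pairing_opp -pairing_cat.
have [s ->] := pairing_dual (x ++ oppx y); rewrite big1 // => b _.
by rewrite pairing_cat pairing_opp (h _ (hfun_bco b)) subrr scaler0.
Qed.

Lemma hfun_sep n (c : C n) : (forall f, hfun n%:Z f -> f c = 0) -> c = 0.
Proof.
move=> h; have [s _ [_ ->]] := bco_sum (kbasis n) c.
by rewrite big1 // => b _; rewrite (h _ (hfun_bco b)) scale0r.
Qed.

(* Flatness of [C n]: membership of [x] in [C n (x) K] can be tested on
   functionals. *)
Lemma tens_flat n V (N K : set V) e (x : seq (C n * V)) : tens n%:Z N e x ->
  (forall f, hfun n%:Z f -> K (pairing f x)) ->
  exists2 y : seq (C n * V), tens n%:Z K e y &
    forall f : {linear C n -> regMod S}, pairing f x = pairing f y.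
Proof.
move=> hx hK; have [s hs] := pairing_dual x.
(* Rewritten in the basis, [x] has its coordinate pairings as right entries, and these lie in [K] by
   assumption. *)
exists [seq (be b, pairing (bco b) x) | b <- s].
  move=> _ /mapP[b _ ->]; split => /=.
  - by rewrite -(kbasis_deg b); apply: be_deg.
  - by apply: hK; apply: hfun_bco.
  by have := tens_deg (hfun_bco b) hx; rewrite subrr add0r.
by move=> f; rewrite hs /pairing big_map.
Qed.

Lemma hfun_diff n m (f : {linear C n -> regMod S}) : hfun m f -> hfun m (f \o d n).
Proof. by move=> hf i c hc; apply: hf; apply: diff_deg. Qed.

(* Since [C m] is generated in degree [m], the tensor [c (x) v] is a sum of
   tensors of elements of degree [m] with elements of [N]. *)
Lemma tens_norm m j e V (N : set V) (c : C m) v : submod N -> homog N -> N v ->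
  exists2 x : seq (C m * V), tens m%:Z N (e - (m%:Z - j)) x &
    forall f, hfun j f -> mcomp e ((f c : S) *: v) = pairing f x.
Proof.
move=> sN hN hv.
pose U := [set c : C m | forall v, N v ->
  exists2 x : seq (C m * V), tens m%:Z N (e - (m%:Z - j)) x &
    forall f, hfun j f -> mcomp e ((f c : S) *: v) = pairing f x].
have sU : submod U.
  split => [w hw|a c1 c2 h1 h2 w hw].
    exists [::] => // f _.
    by rewrite linear0 scale0r mcomp0 pairing_nil.
  (* The scalar [a] moves across the tensor onto [w]; this is why [U] quantifies over all of [N]. *)
  have [x1 hx1 hf1] := h1 _ (submodZ a sN hw).
  have [x2 hx2 hf2] := h2 _ hw.
  exists (x1 ++ x2); first exact: tens_cat.
  move=> f hf; rewrite pairing_cat -hf1 // -hf2 // linearP scalerDl mcompD.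
  by rewrite scalerA mulrC.
suff : U c by apply.
have : gen_deg m%:Z c by rewrite hgen.
apply: (span_sub sU) => {v hv}c hc v hv.
exists [:: (c, mcomp (e - (m%:Z - j)) v)].
  move=> p; rewrite inE => /eqP -> /=; split => //; first exact: hN.
  exact: mcompP.
by move=> f hf; rewrite pairing_seq1 (mcomp_scale _ _ (hf _ _ hc)).
Qed.

(** Puts [(d (x) id) y] in normal form: [d c] has degree [n + 1] in a module generated in degree
    [n], so one degree passes to the right entry. *)
Lemma tens_diff n V (N : set V) e (y : seq (C n.+1 * V)) :
  submod N -> homog N -> tens n.+1%:Z N e y ->
  exists2 x : seq (C n * V), tens n%:Z N (e + 1) x &
    forall f : {linear C n -> regMod S}, pairing (f \o d n) y = pairing f x.
Proof.
move=> sN hN; elim: y => [|[c v] y IH] hy.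
  by exists [::] => // f; rewrite !pairing_nil.
have [|x hx hf] := IH; first by move=> p hp; apply: hy; rewrite inE hp orbT.
have [/= hc hv hve] := hy _ (mem_head _ _).
have [x1] := tens_norm n%:Z (e + 1) (d n c) sN hN hv.
rewrite subrr subr0 => hx1 hf1; exists (x1 ++ x); first exact: tens_cat.
suff h : forall f : {linear C n -> regMod S},
    pairing f ((d n c, v) :: [seq (d n p.1, p.2) | p <- y]) = pairing f (x1 ++ x).
  by move=> f; rewrite -h /pairing !big_cons big_map.
apply: pairing_ext => f hfn; rewrite pairing_cat -hf -hf1 //.
rewrite /pairing !big_cons big_map /= mcomp_id //.
have -> : e + 1 = (n.+1%:Z - n%:Z) + e by lia.
by apply: gm_scale => //; apply: hfn; apply: diff_deg.
Qed.

Lemma kos_exact n (c : C n.+1) : d n c = 0 -> exists c', c = d n.+1 c'.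
Proof.
move=> hc; case: hC => _ _ /(_ n.+1 isT) h _.
have [|y [z [/= -> _ ->]]] := h c; first by split.
by exists z; rewrite add0r.
Qed.

Lemma aug_diff0 i (c : C 0%N) : gm_deg i c -> i <= 0 -> max_ideal (aug c) -> c = 0.
Proof.
move=> hc hi hm; case: hC => _ _ _ [_ _ /(_ c I hm) [y [z [/= -> _ hz]]] _].
rewrite -(mcomp_id hc) hz add0r (mcomp_lin (@diff_deg _ _ C 0%N)).
by rewrite (@kos_low 1 i (mcomp i z)) ?linear0 //; apply: mcompP.
Qed.

Lemma max_ideal_submod : submod (@max_ideal k S). Proof. exact: span_submod. Qed.

(** Thus [C 0] is free of rank one on [u]: for [x] of degree 0 the element [x - aug x *: u] is
    killed by [aug], so it is a boundary of degree 0, while [C 1] starts in degree 1. *)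
Lemma aug_unit : exists2 u, aug u = 1 & forall c, c = (aug c : S) *: u.
Proof.
case: hC => _ haug _ [_ _ _ /(_ 1 I) [x0 _ hx0]].
(* [aug] is onto only modulo m. As m vanishes in degree 0, the degree 0 component of [x0] maps
   exactly to 1. *)
have hm0 : @mcomp k S (regMod S) 0 ((1 : S^o) - aug x0) = 0.
  apply: (span_deg (T := [set 0])) hx0 => //; first by move=> v [i _ hi]; exists i.
  move=> v i a [j hj hv] hi ha.
  have [->|v0] := eqVneq v 0; first by rewrite /= scaler0.
  by rewrite /= (sga_neg _ ha) ?scale0r // (gm_deg_uniq hi hv v0); lia.
pose u := mcomp 0 x0; have hu : gm_deg 0 u by apply: mcompP.
have hu1 : aug u = 1.
  move/eqP: hm0; rewrite mcompB subr_eq0 (mcomp_lin haug) => /eqP <-.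
  by apply: mcomp_id; apply: sga_deg1.
exists u => // c.
have sU : submod [set c | c = (aug c : S) *: u].
  split; first by rewrite /= linear0 scale0r.
  by move=> a x y /= hx hy; rewrite {1}hx {1}hy linearP scalerDl scalerA.
have : gen_deg 0%:Z c by rewrite hgen.
apply: (span_sub sU) => x hx /=; apply/eqP; rewrite -subr_eq0; apply/eqP.
apply: (@aug_diff0 0) => //.
  apply: (gradingB (gm_grading _)) => //; rewrite -(addr0 0); apply: gm_scale => //.
  exact: haug hx.
rewrite linearB linearZ /= hu1.
have -> : aug x - (aug x : S) *: 1 = 0 :> regMod S.
  by apply/eqP; rewrite subr_eq0 eq_sym; apply/eqP; apply: mulr1.
exact: submod0 max_ideal_submod.
Qed.

(** [a *: u] maps to zero in the residue field, so exactness at [C 0] makes it a boundary. *)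
Lemma aug_diff_im (a : S) i : 0 < i -> sga_deg i a -> exists c, aug (d 0%N c) = a.
Proof.
move=> hi ha; have [u hu _] := aug_unit.
have hm : @max_ideal k S a by apply: span_gen; exists i.
have hau : aug (a *: u) = a by rewrite linearZ hu; apply: mulr1.
case: hC => _ _ _ [_ _ h _].
have [|y [z [/= -> _ hz]]] := h (a *: u) I; first by rewrite /= hau.
by exists z; rewrite -[d _ z]add0r -hz.
Qed.

(* [Tor_(n+1)(N, k)_(n+1+e) = 0], with Tor computed as the homology of
   [C (x) N]; equality of tensors is tested on functionals. *)
Definition tor_zero V (N : set V) n e : Prop :=
  forall x : seq (C n.+1 * V), tens n.+1%:Z N e x ->
    (forall f, hfun n%:Z f -> pairing (f \o d n) x = 0) ->
  exists2 y : seq (C n.+2 * V), tens n.+2%:Z N (e - 1) y &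
    forall f, hfun n.+1%:Z f -> pairing f x = pairing (f \o d n.+1) y.

(** [G] is the graded free submodule on a subset of the basis; the instances are the whole module
    and [gen_le d]. *)
Definition free_span P (B : basis P) (G : set P) : Prop :=
  [/\ submod G, homog G & forall x (b : bI B), G x -> bco b x != 0 -> G (be b)].

(** Writing the tensor as the sum of [z b (x) be b] separates the cycle condition over the basis:
    each [z b] is a cycle of [C], hence a boundary. *)
Lemma tor_zero_free P (B : basis P) (G : set P) n e : free_span B G -> tor_zero G n e.
Proof.
move=> [sG hG hBG] x hx hcyc.
have [s us hs] := bco_sum_seq B [seq p.2 | p <- x].
pose z (b : bI B) : C n.+1 := \sum_(p <- x) (bco b p.2 : S) *: p.1.
have hz (f : {linear C n.+1 -> regMod S}) : pairing f x = \sum_(b <- s) (f (z b) : S) *: be b.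
  rewrite /pairing; under [RHS]eq_bigr do rewrite linear_sum scaler_suml.
  rewrite exchange_big /= big_seq [RHS]big_seq; apply: eq_bigr => p hp.
  rewrite {1}(hs p.2); last by apply/mapP; exists p.
  rewrite scaler_sumr; apply: eq_bigr => b _.
  by rewrite functionalZ scalerA mulrC.
have dz b : b \in s -> d n (z b) = 0.
  move=> hb; apply: hfun_sep => f hf.
  have h0 : (0 : P) = \sum_(b <- s) (f (d n (z b)) : S) *: be b.
    by rewrite -(hz (f \o d n)) hcyc.
  by rewrite -(bco_uniq us h0 hb) linear0.
have hy b : b \in s -> exists y : seq (C n.+2 * P), tens n.+2%:Z G (e - 1) y /\
    forall f, hfun n.+1%:Z f -> mcomp e ((f (z b) : S) *: be b) = pairing (f \o d n.+1) y.
  (* A basis element outside [G] occurs in no right entry, so its coefficient [z b] is zero. *)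
  move=> hb; have [hGb|hGb] := pselect (G (be b)); last first.
    have z0 : z b = 0.
      rewrite /z big_seq big1 // => p /hx [_ hp _].
      suff -> : bco b p.2 = 0 by rewrite scale0r.
      by apply: contra_notP hGb => /eqP; apply: hBG.
    by exists [::]; split => // f _; rewrite z0 linear0 scale0r mcomp0 pairing_nil.
  have [w hw] := kos_exact (dz b hb).
  have [y] := tens_norm n.+1%:Z e w sG hG hGb.
  rewrite (_ : e - (n.+2%:Z - n.+1%:Z) = e - 1); last by lia.
  by move=> h1 h2; exists y; split => // f hf; rewrite hw -h2 //; apply: hfun_diff.
have [y hy1 hy2] : exists2 y : seq (C n.+2 * P), tens n.+2%:Z G (e - 1) y &
    forall f, hfun n.+1%:Z f ->
    mcomp e (\sum_(b <- s) (f (z b) : S) *: be b) = pairing (f \o d n.+1) y.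
  elim: s hy {us hs hz dz} => [|b s IH] hy.
    by exists [::] => // f _; rewrite big_nil mcomp0 pairing_nil.
  have [|y1 h1 h2] := IH; first by move=> b' hb'; apply: hy; rewrite inE hb' orbT.
  have [y2 [h3 h4]] := hy b (mem_head _ _).
  exists (y2 ++ y1); first exact: tens_cat.
  by move=> f hf; rewrite big_cons mcompD pairing_cat h2 // h4.
exists y => // f hf; rewrite -hy2 // -hz mcomp_id //.
by have := tens_deg hf hx; rewrite subrr add0r.
Qed.

(** * Dimension shifting along [0 -> K -> G -> N -> 0] with [G] free *)

Section Cover.
Variables (P W : grMod S) (g : {linear P -> W}) (B : basis P) (G K : set P) (N : set W).
Hypotheses (hg : deg_preserving g) (hG : free_span B G) (hN : N = g @` G)
  (hK : K = G `&` [set x | g x = 0]).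

Let sG : submod G. Proof. by case: hG. Qed.
Let gG : homog G. Proof. by case: hG. Qed.
Let sK : submod K.
Proof. by rewrite hK; apply: submodI => //; apply: (submod_preim g (@submod_set0 _ _)). Qed.
Let gK : homog K.
Proof. by rewrite hK; apply: homogI => //; apply: (homog_preim hg (@homog_set0 _ _ _)). Qed.
Let KG : K `<=` G. Proof. by rewrite hK => x []. Qed.
Let gK0 x : K x -> g x = 0. Proof. by rewrite hK => -[]. Qed.
Let GN x : G x -> N (g x). Proof. by rewrite hN; exists x. Qed.
Let push n (x : seq (C n * P)) : seq (C n * W) := [seq (p.1, g p.2) | p <- x].

Let lift n e (y : seq (C n * W)) : tens n%:Z N e y ->
  exists2 x : seq (C n * P), tens n%:Z G e x & y = push x.
Proof. by rewrite hN; apply: tens_lift. Qed.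

(** The step behind the connecting map: if [x] becomes a boundary over [N], subtracting the boundary
    of a lift to [G] leaves a tensor over [K], by flatness. *)
Let lift_bound n e (x : seq (C n * P)) (y : seq (C n.+1 * W)) :
  tens n%:Z G (e + 1) x -> tens n.+1%:Z N e y ->
  (forall f, hfun n%:Z f -> pairing f (push x) = pairing (f \o d n) y) ->
  exists z : seq (C n.+1 * P), exists w : seq (C n * P),
    [/\ tens n.+1%:Z G e z, tens n%:Z K (e + 1) w &
    forall f : {linear C n -> regMod S},
      pairing f x = pairing f w + pairing (f \o d n) z].
Proof.
move=> hx hy hxy; have [z hz ey] := lift hy.
have [t ht htz] := tens_diff sG gG hz.
have [|f hf|w hw hwx] := @tens_flat n P G K (e + 1) (x ++ oppx t).
- by apply: tens_cat => //; apply: tens_opp.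
- rewrite hK pairing_cat pairing_opp -htz; split.
    by apply: submodB => //; [apply: tens_mem hx|apply: tens_mem hz].
  by have := hxy f hf; rewrite /= linearB ey !pairing_map => ->; rewrite subrr.
exists z, w; split=> // f.
by rewrite -hwx pairing_cat pairing_opp htz subrK.
Qed.

(** Diagram chase in [0 -> C (x) K -> C (x) G -> C (x) N -> 0], where [tor_zero_free] handles the
    middle term. The internal degree is kept, so [e] rises as the homological index falls. *)
Lemma tor_zero_shift n e : tor_zero N n.+1 e <-> tor_zero K n (e + 1).
Proof.
split=> h x hx hcyc.
  have [y hy hxy] := tor_zero_free hG (tens_sub KG hx) hcyc.
  rewrite addrK in hy *.
  have [||z hz hyz] := h (push y).
  - exact: tens_map hy.
  - move=> f hf; rewrite pairing_map -hxy // gK0 //; exact: tens_mem hx.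
  have hy' : tens n.+2%:Z G (e - 1 + 1) y by rewrite subrK.
  have [z' [w [hz' hw hyw]]] := lift_bound hy' hz hyz.
  rewrite subrK in hw; exists w => // f hf.
  rewrite hxy // hyw [X in _ + X]big1 ?addr0 // => p _.
  by rewrite /= diff_diff linear0 scale0r.
have [x' hx' ex] := lift hx.
have [t ht htx] := tens_diff sG gG hx'.
have [f hf|t' ht' htt'] := tens_flat (K := K) ht.
  rewrite hK -htx; split; first exact: tens_mem hx'.
  by rewrite /= -pairing_map -/(push _) -ex hcyc.
have [|y hy hty] := h t' ht'.
  move=> f hf; rewrite -htt' -htx /pairing big1 // => p _.
  by rewrite /= diff_diff linear0 scale0r.
rewrite addrK in hy.
have [||z hz hxz] := @tor_zero_free P B G n.+1 e hG (x' ++ oppx y).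
- by apply: tens_cat => //; apply: tens_opp; apply: tens_sub hy.
- move=> f hf; rewrite pairing_cat (pairing_opp (f \o d n.+1)) htx htt' hty //.
  by rewrite subrr.
exists (push z); first exact: tens_map hz.
move=> f hf; rewrite ex !pairing_map -hxz // pairing_cat pairing_opp linearB.
by rewrite [g (pairing f y)]gK0 ?subr0 //; apply: tens_mem hy.
Qed.

(** By [aug_diff_im] the map [aug \o d] reaches every scalar involved in m X; [tens_norm] then
    brings the left entries to degree 1. *)
Let mmul_tens V (X : set V) e x : submod X -> homog X -> mmul X x ->
  exists2 y : seq (C 1%N * V), tens 1%:Z X e y &
    mcomp (e + 1) x = pairing (aug \o d 0%N) y.
Proof.
have hf : hfun 0 (aug \o d 0%N).
  by move=> i c hc; rewrite subr0; case: hC => _ ha _ _; apply: ha; apply: diff_deg.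
move=> sX gX [n [c [v [hv ->]]]]; elim: n c v hv => [|n IH] c v hv.
  by exists [::] => //; rewrite big_ord0 mcomp0 pairing_nil.
have [y hy hyx] := IH (fun t => c (fintype.lift ord0 t)) _
  (fun t => hv (fintype.lift ord0 t)).
have [i [a [w [hi ha hw hvw]]]] := hv ord0.
have [b hb] := aug_diff_im hi ha.
have [z] := tens_norm 0 (e + 1) b sX gX (submodZ (c ord0) sX hw).
rewrite (_ : e + 1 - (1%:Z - 0) = e); last by lia.
move=> hz hzx; exists (z ++ y); first exact: tens_cat.
by rewrite big_ord_recl mcompD hyx pairing_cat -hzx // hvw /= hb !scalerA mulrC.
Qed.

(** The start of the shift: Tor_1(N, k) is the kernel of K / m K -> G / m G, here read in degree
    [e + 1]. *)
Lemma tor_zero_base e : tor_zero N 0 e <->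
  (forall x, gm_deg (e + 1) x -> K x -> mmul G x -> mmul K x).
Proof.
have hf : hfun 0 aug.
  by move=> i c hc; rewrite subr0; case: hC => _ ha _ _; apply: ha.
split=> [h x hxe hKx hmx|h x hx hcyc].
  have [y hy] := mmul_tens e sG gG hmx; rewrite mcomp_id // => hxy.
  have [||z hz hyz] := h (push y); first exact: tens_map hy.
    (* Since [C 0] has rank one, every functional on it is a multiple of [aug], and one test
       suffices. *)
    move=> f _; have [u _ hu] := aug_unit.
    suff -> : pairing (f \o d 0%N) (push y) = (f u : S) *: pairing (aug \o d 0%N) (push y).
      by rewrite [pairing _ (push y)]pairing_map -hxy gK0 ?scaler0.
    rewrite /pairing scaler_sumr; apply: eq_bigr => p _.
    by rewrite /= [in LHS](hu (d 0%N p.1)) functionalZ scalerA mulrC.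
  have hy' : tens 1%:Z G (e - 1 + 1) y by rewrite subrK.
  have [z' [w [_ hw hyw]]] := lift_bound hy' hz hyz.
  rewrite hxy hyw [X in _ + X]big1 => [|p _]; last first.
    by rewrite /= diff_diff linear0 scale0r.
  rewrite addr0; apply: submod_sum => // p /hw [hp1 hp2 _].
  apply: mmul_gen hp2; first exact: ltr01.
  by have := hfun_diff hf hp1; rewrite subr0.
have [x' hx' ex] := lift hx.
(* [t] represents the image of the class of [x] under the connecting map. *)
pose t := pairing (aug \o d 0%N) x'.
have hte : gm_deg (e + 1) t.
  by have := tens_deg (hfun_diff hf) hx'; rewrite subr0 addrC.
have hKt : K t.
  rewrite hK; split; first exact: tens_mem hx'.
  by rewrite /= -pairing_map -/(push _) -ex hcyc.
have hmt : mmul G t.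
  apply: submod_sum => // p /hx' [hp1 hp2 _].
  apply: mmul_gen hp2; first exact: ltr01.
  by have := hfun_diff hf hp1; rewrite subr0.
have [y hy] := mmul_tens e sK gK (h t hte hKt hmt); rewrite mcomp_id // => hty.
have [||z hz hxz] := @tor_zero_free P B G 0 e hG (x' ++ oppx y).
- by apply: tens_cat => //; apply: tens_opp; apply: tens_sub hy.
- move=> f _; have [u _ hu] := aug_unit.
  suff h1 (s : seq (C 1%N * P)) :
      pairing (f \o d 0%N) s = (f u : S) *: pairing (aug \o d 0%N) s.
    by rewrite h1 pairing_cat (pairing_opp (aug \o d 0%N)) -hty subrr scaler0.
  rewrite /pairing scaler_sumr; apply: eq_bigr => p _.
  by rewrite /= [in LHS](hu (d 0%N p.1)) functionalZ scalerA mulrC.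
exists (push z); first exact: tens_map hz.
move=> f hff; rewrite ex !pairing_map -hxz // pairing_cat pairing_opp linearB.
by rewrite [g (pairing f y)]gK0 ?subr0 //; apply: tens_mem hy.
Qed.

End Cover.

End KoszulHomology.

(** * Tor and resolutions of the module *)

Section Resolutions.
Variables (k : fieldType) (S : stdGradedAlg k).
Implicit Types (V W P : grMod S) (n m : nat) (i j e d : int).

(** The cycle condition is tested in [V], so [N] enters only through the right entries of [x] and
    [y], in degrees [e] and [e - 1]. *)
Lemma tor_zero_eq (C : grComplex S) V (N K : set V) n e :
  (forall i v, (i == e) || (i == e - 1) -> gm_deg i v -> N v <-> K v) ->
  tor_zero C N n e -> tor_zero C K n e.
Proof.
move=> h hN x hx hcyc.
have [|y hy hxy] := hN x _ hcyc.
  by move=> p /hx [h1 h2 h3]; split => //; apply/(h e); rewrite ?eqxx.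
exists y => // p /hy [h1 h2 h3]; split => //.
by apply/(h (e - 1)); rewrite ?eqxx ?orbT.
Qed.

Lemma tor_zero_gen_deg (C : grComplex S) V d n e : d < e ->
  tor_zero C (@gen_le k S V d) n e <-> tor_zero C (@gen_deg k S V d) n e.
Proof.
move=> de; have h i v : (i == e) || (i == e - 1) -> gm_deg i v ->
    @gen_le k S V d v <-> gen_deg d v.
  move=> hi hv; split => [|/gen_deg_sub_le//]; apply: gen_le_gen_deg hv.
  by case/orP: hi => /eqP ->; lia.
by split; apply: tor_zero_eq => i v hi hv; [|apply: iff_sym]; apply: h hi hv.
Qed.

Lemma tor_zero_low (C : grComplex S) V d n e : e < d ->
  tor_zero C (@gen_deg k S V d) n e.
Proof.
move=> ed x hx _; exists [::] => // f _; rewrite pairing_nil /pairing big_seq big1 //.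
by move=> p /hx [_ h1 h2]; rewrite (gen_deg_low ed h2 h1) scaler0.
Qed.

Lemma free_span_setT P (B : basis P) : free_span B setT.
Proof. by []. Qed.

(** Coordinates at basis elements of degree above [d] vanish on the generators, because [S] has no
    negative part. *)
Lemma free_span_gen_le P (B : basis P) d : free_span B (gen_le d).
Proof.
split=> // x b hx; have [hb _|hb] := leP (bd b) d.
  by apply: gen_le_gen hb (be_deg b).
rewrite (gen_le_sub (functional_ker (bco b)) _ hx) ?eqxx // => i y hi hy.
by apply: (@sga_neg _ _ (i - bd b)); [lia|apply: bco_deg].
Qed.

Lemma be_not_mmul P (B : basis P) (b : bI B) : ~ mmul setT (be b).
Proof.
move=> h; have hs := functional_ker (bco b).
have : [set y | bco b y = 0] (mcomp (bd b) (be b)).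
  apply: (mmul_deg _ _ _ h) => // v i hi _ hv.
  by apply: (@sga_neg _ _ (i - bd b)); [lia|apply: bco_deg].
by rewrite /= mcomp_id ?bco_be ?eqxx; [move/eqP; rewrite oner_eq0|apply: be_deg].
Qed.

(** * Kernels in an augmented complex and iterated dimension shifting *)

Section Augmented.
Variables (F : grComplex S) (V : grMod S) (eps : {linear F 0%N -> V}).

Definition aug_ker n : set (F n) :=
  match n return set (F n) with
  | 0 => [set x | eps x = 0]
  | m.+1 => [set x | diff F m x = 0]
  end.

Lemma aug_ker_submod n : submod (@aug_ker n).
Proof. by case: n => [|n]; apply: (submod_preim _ (@submod_set0 _ _)). Qed.

Hypothesis heps : deg_preserving eps.

Lemma aug_ker_homog n : homog (@aug_ker n).
Proof.
case: n => [|n]; first exact: (homog_preim heps (@homog_set0 _ _ _)).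
exact: (homog_preim (@diff_deg _ _ F n) (@homog_set0 _ _ _)).
Qed.

Section Resolution.
Variable N : set V.
Hypothesis hres : free_resolution (sq_sub N) eps.

Lemma res_exact n x : aug_ker x <-> exists z, x = diff F n z.
Proof.
case: hres => _ _ hF [_ h2 h3 _]; split.
  case: n x => [|n] x hx.
    have [y [z [/= -> _ ->]]] := h3 x I hx.
    by exists z; rewrite add0r.
  have [|y [z [/= -> _ ->]]] := hF n.+1 isT x; first by split.
  by exists z; rewrite add0r.
case: n x => [|n] x [z ->]; last exact: diff_diff.
by apply: h2; exists 0, z; split => //; rewrite add0r.
Qed.

Lemma res_cover : N = eps @` setT.
Proof.
case: hres => _ _ _ [h1 _ _ h4]; apply/seteqP; split => [y hy|_ [x _ <-]].
  have [x _ /= /eqP] := h4 y hy; rewrite subr_eq0 => /eqP ->.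
  by exists x.
exact: h1.
Qed.

Definition res_basis n : basis (F n) :=
  inhabited_witness (graded_free_basis (let: And4 h _ _ _ := hres in h n)).

Lemma res_comp n i x : gm_deg i x -> aug_ker x ->
  exists2 z, gm_deg i z & x = diff F n z.
Proof.
move=> hx /res_exact [z hz]; exists (mcomp i z); first exact: mcompP.
by rewrite -(mcomp_lin (@diff_deg _ _ F n)) -hz mcomp_id.
Qed.

End Resolution.

Section Chain.
Variables (C : grComplex S) (aug : {linear C 0%N -> regMod S}).
Hypothesis hC : free_resolution (residue_field S) aug.
Hypothesis hgen : forall n : nat, @gen_deg k S (C n) n%:Z = setT.
Variables (B : forall n, basis (F n)) (G : forall n, set (F n)).
Arguments G : clear implicits.
Hypothesis hG : forall n, free_span (B n) (G n).
Variable N : set V.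
Hypothesis hN : N = eps @` G 0%N.

Let K n := G n `&` @aug_ker n.
Arguments K : clear implicits.

(** The shift is applied once along [eps] and then along [G l.+1 -> K l] for [l < m], so [e] grows
    by [m + 1]. *)
Lemma tor_zero_iter m : (forall n, (n < m)%N -> K n = diff F n @` G n.+1) ->
  forall n e, tor_zero C N (m + n).+1 e <-> tor_zero C (K m) n (e + m.+1%:Z).
Proof.
elim: m => [|m IH] hK n e; first exact: (tor_zero_shift hC hgen heps (hG 0) hN).
rewrite addSnnS IH => [|l hl]; last by apply: hK; apply: ltn_trans hl _.
rewrite (tor_zero_shift (K := K m.+1) hC hgen (@diff_deg _ _ F m) (hG m.+1)
  (hK m (ltnSn m))) //.
by have -> : e + m.+1%:Z + 1 = e + m.+2%:Z by lia.
Qed.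

(* Iterating the shift along the exact part of [... -> G 1 -> G 0 -> N] reduces
   [Tor_(m+1)(N, k)] to the kernel of [K m / m (K m) -> G m / m (G m)]. *)
Lemma tor_zero_chain m e : (forall n, (n < m)%N -> K n = diff F n @` G n.+1) ->
  tor_zero C N m e <->
  (forall x, gm_deg (e + m%:Z + 1) x -> K m x -> mmul (G m) x -> mmul (K m) x).
Proof.
case: m => [|m] hK.
  by rewrite addr0; apply: (tor_zero_base hC hgen heps (hG 0) hN).
rewrite -{1}[m]addn0 tor_zero_iter => [|l hl]; last by apply: hK; apply: ltn_trans hl _.
exact: (tor_zero_base (K := K m.+1) hC hgen (@diff_deg _ _ F m) (hG m.+1) (hK m (ltnSn m))).
Qed.

End Chain.

End Augmented.

(** * Betti numbers through the Koszul resolution *)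

Section BettiTor.
Variables (C : grComplex S) (aug : {linear C 0%N -> regMod S}).
Hypothesis hC : free_resolution (residue_field S) aug.
Hypothesis hgen : forall n : nat, @gen_deg k S (C n) n%:Z = setT.

(** Balancing of Tor: with [K] the kernel at position [n], both sides say that the degree [j]
    elements of [K] in m F_n lie in m K. As [F] is any resolution of [N], the one chosen in
    [betti_vanishes] does not matter. *)
Lemma homology_tensor_tor (F : grComplex S) V (eps : {linear F 0%N -> V}) (N : set V) n j :
  free_resolution (sq_sub N) eps ->
  sq_zero (deg_part (homology_tensor_k F n.+1) j) <-> tor_zero C N n (j - n.+1%:Z).
Proof.
move=> hres; have heps : deg_preserving eps by case: hres.
have hK m : setT `&` @aug_ker F V eps m = diff F m @` setT.
  rewrite setTI; apply/seteqP; split => x.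
    by move=> /(res_exact hres) [z ->]; exists z.
  by move=> [z _ <-]; apply/(res_exact hres); exists z.
rewrite (tor_zero_chain (G := fun n => setT) heps hC hgen
  (fun m => free_span_setT (res_basis hres m)) (res_cover hres) _ (fun m _ => hK m)).
rewrite (_ : j - n.+1%:Z + n%:Z + 1 = j); last by lia.
rewrite setTI; split=> h x.
  move=> hx hKx hmx; have [z hz hxz] := res_comp hres hx hKx.
  have [|[y [w [hy _ hzy]]] _] := h z.
    by split => //; split => //; rewrite /= max_ideal_mulE -hxz.
  rewrite hxz hzy linearD diff_diff addr0.
  rewrite /= max_ideal_mulE in hy.
  apply: lin_mmul hy => t _; apply/(res_exact hres); by exists t.
move=> [[_ hdx] hx]; split => //.
rewrite /= max_ideal_mulE in hdx.
have hker : aug_ker eps (diff F n x) by apply/(res_exact hres); exists x.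
have := h _ (@diff_deg _ _ F n _ _ hx) hker hdx.
rewrite -(setTI (@aug_ker _ _ eps n)) hK => /mmul_lift [y hy hyx].
have [|z hz] := (res_exact hres (n := n.+1) (x - y)).1.
  by rewrite /= linearB hyx subrr.
by exists y, z; split => //; rewrite /= ?max_ideal_mulE // -hz addrC subrK.
Qed.

Lemma betti_tor V (N : set V) n j :
  betti_vanishes (sq_sub N) n.+1 j -> tor_zero C N n (j - n.+1%:Z).
Proof. by move=> [F [eps [hres h]]]; apply/(homology_tensor_tor n j hres). Qed.

End BettiTor.

Lemma homology_tensor0 (F : grComplex S) V (eps : {linear F 0%N -> V}) (N : set V) j :
  free_resolution (sq_sub N) eps ->
  (forall x, gm_deg j x -> N x -> mmul N x) ->
  sq_zero (deg_part (homology_tensor_k F 0) j).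
Proof.
move=> hres hN x [_ hx]; have heps : deg_preserving eps by case: hres.
have hNx : N (eps x) by rewrite (res_cover hres); exists x.
have := hN _ (heps _ _ hx) hNx; rewrite {1}(res_cover hres) => /mmul_lift [y hy hyx].
have [|z hz] := (res_exact hres (n := 0) (x - y)).1.
  by rewrite /= linearB hyx subrr.
split=> //; exists y, z; split => //; rewrite /= ?max_ideal_mulE // -hz addrC subrK //.
Qed.

End Resolutions.

(** * Existence of free resolutions *)

Section FreeCover.
Variables (k : fieldType) (S : stdGradedAlg k) (V : grMod S).

Definition fin_supp : {pred ((int * V)%type -> S^o)} :=
  fun f => `[< exists s, supp_in f s >].

Lemma fin_suppP (f : int * V -> S^o) : reflect (exists s, supp_in f s) (f \in fin_supp).
Proof. exact: asboolP. Qed.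

Fact fin_supp_closed : GRing.submod_closed fin_supp.
Proof.
split; first by apply/fin_suppP; exists [::].
move=> a f g /fin_suppP[s hs] /fin_suppP[t ht]; apply/fin_suppP.
exists (s ++ t) => p; rewrite mem_cat negb_or => /andP[ps pt].
by rewrite /GRing.add /= /GRing.scale /= hs // ht // scaler0 addr0.
Qed.

HB.instance Definition _ := GRing.isSubmodClosed.Build S ((int * V)%type -> S^o) fin_supp
  fin_supp_closed.

(* The free module on all pairs [(i, v)], the generator [(i, v)] having degree
   [i]. *)
Record free_pre := FreePre { free_fun :> (int * V)%type -> S^o; _ : free_fun \in fin_supp }.
HB.instance Definition _ := [isSub for free_fun].
HB.instance Definition _ := [Choice of free_pre by <:].
HB.instance Definition _ := [SubChoice_isSubLmodule of free_pre by <:].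

Definition free_deg (j : int) : set free_pre :=
  [set f | forall p, sga_deg (j - p.1) (f p : S)].

Lemma freeD (f g : free_pre) p : (f + g) p = f p + g p. Proof. by []. Qed.
Lemma freeZ (a : S) (f : free_pre) p : (a *: f) p = a * f p :> S. Proof. by []. Qed.
Lemma free_sum (J : Type) (r : seq J) (f : J -> free_pre) p :
  (\sum_(j <- r) f j) p = \sum_(j <- r) f j p.
Proof. by elim/big_rec2: _ => // j x y _ <-. Qed.

Lemma free_eq (f g : free_pre) : (forall p, f p = g p) -> f = g.
Proof. by move=> h; apply: val_inj; apply/funext. Qed.

Definition free_mk (f : int * V -> S^o) (hf : exists s, supp_in f s) : free_pre :=
  FreePre (introT (fin_suppP f) hf).

Fact free_grading : is_grading free_deg.
Proof.
pose gS := sga_grading S; split.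
- by move=> i p; apply: (grading0 gS).
- by move=> i f g hf hg p; apply: (gradingB gS).
- move=> f; have [s hs] := elimT (fin_suppP f) (valP f).
  pose u (p : int * V) := sval (cid2 (comp_sum gS (f p : S))).
  have hu p : uniq (u p) /\ supp_in ((hcomp gS)^~ (f p : S)) (u p) /\
      (f p : S) = \sum_(i <- u p) hcomp gS i (f p) by rewrite /u; case: cid2.
  pose t := undup (flatten [seq [seq l + p.1 | l <- u p] | p <- s]).
  have hfin i : exists s', supp_in (fun p : int * V => scomp (i - p.1) (f p : S) : S^o) s'.
    by exists s => p /hs ->; apply: (@mcomp0 _ _ (regMod S)).
  exists t, (fun i => free_mk (hfin i)); split.
    by move=> i p; apply: scompP.
  apply: free_eq => p; rewrite free_sum /=.
  have [ps|ps] := boolP (p \in s); last first.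
    rewrite (hs _ ps) big1 // => i _; apply: (@mcomp0 _ _ (regMod S)).
  have [uu [su eu]] := hu p.
  have supp_u : supp_in (fun i => scomp (i - p.1) (f p : S)) [seq l + p.1 | l <- u p].
    move=> i hi; apply: su; apply: contra hi => hi.
    by apply/mapP; exists (i - p.1) => //; rewrite subrK.
  rewrite (sum_supp (s := t) (t := [seq l + p.1 | l <- u p])) //.
  - by rewrite big_map {1}eu; apply: eq_bigr => l _; rewrite /scomp addrK.
  - exact: undup_uniq.
  - by rewrite map_inj_uniq //; apply: addIr.
  move=> i; rewrite mem_undup => hi; apply: supp_u; apply: contra hi => hi.
  by apply/flattenP; exists [seq l + p.1 | l <- u p] => //; apply/mapP; exists p.
move=> s f us hf hs i hi; apply: free_eq => p.
have := @grading_direct _ _ _ gS [seq l - p.1 | l <- s] (fun l => f (l + p.1) p : S).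
move=> /(_ _ _ _ (i - p.1)); rewrite subrK; apply.
- by rewrite map_inj_uniq //; apply: addIr.
- by move=> l; have := hf (l + p.1) p; rewrite addrK.
- rewrite big_map; transitivity ((\sum_(l <- s) f l) p); last by rewrite hs.
  by rewrite free_sum; apply: eq_bigr => l _; rewrite subrK.
by apply/mapP; exists i.
Qed.

Fact free_scale i j (a : S) f : sga_deg i a -> free_deg j f -> free_deg (i + j) (a *: f).
Proof. by move=> ha hf p; rewrite -addrA; apply: sga_mul. Qed.

Definition free_mod : grMod S := GrMod free_grading free_scale.

Fact free_gen_supp (p : int * V) :
  exists s, supp_in (fun q : int * V => (if q == p then 1 else 0) : S^o) s.
Proof. by exists [:: p] => q; rewrite inE => /negbTE ->. Qed.

Definition free_gen (p : int * V) : free_mod := free_mk (free_gen_supp p).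

Lemma free_genZ (c : S) p q : (c *: free_gen p : free_pre) q = if q == p then c else 0.
Proof. by rewrite freeZ /=; case: eqP => _; [apply: mulr1|apply: mulr0]. Qed.

Lemma free_genZ_sum (c : int * V -> S) s q : uniq s ->
  (\sum_(p <- s) c p *: free_gen p : free_pre) q = if q \in s then c q else 0.
Proof.
move=> us; rewrite free_sum; under eq_bigr do rewrite free_genZ.
have [qs|qs] := boolP (q \in s).
  rewrite (bigD1_seq q qs us) /= eqxx big1 ?addr0 // => p.
  by rewrite eq_sym => /negbTE ->.
rewrite big_seq big1 // => p ps; rewrite (_ : (q == p) = false) //.
by apply: contraNF qs => /eqP ->.
Qed.

Lemma free_expand (f : free_mod) s : uniq s -> supp_in (f : free_pre) s ->
  f = \sum_(p <- s) ((f : free_pre) p : S) *: free_gen p.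
Proof.
move=> us hs; apply: (@free_eq f) => q; rewrite free_genZ_sum //.
by case: ifPn => // /hs.
Qed.

Lemma free_mod_free : graded_free free_mod.
Proof.
exists (int * V)%type, free_gen; split.
- move=> p; exists p.1 => q /=; case: eqP => [->|_]; first by rewrite subrr; apply: sga_deg1.
  exact: (grading0 (sga_grading S)).
- move=> f; have [s hs] := elimT (fin_suppP (f : free_pre)) (valP (f : free_pre)).
  exists (undup s), (f : free_pre); apply: free_expand; first exact: undup_uniq.
  exact: supp_in_undup.
move=> s c us h p ps; have := free_genZ_sum c p us.
by rewrite ps h => <-.
Qed.

Variable N : set V.

(** Every pair labels a generator; the labels that do not carry an element of [N] with its degree
    are sent to 0. *)
Definition cover_gen (p : int * V) : V :=
  if `[< N p.2 /\ gm_deg p.1 p.2 >] then p.2 else 0.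

Definition cover_fun (f : free_mod) : V :=
  \sum_(p <- undup (sval (cid (elimT (fin_suppP (f : free_pre)) (valP (f : free_pre))))))
    ((f : free_pre) p : S) *: cover_gen p.

Lemma cover_funE (f : free_mod) s : uniq s -> supp_in (f : free_pre) s ->
  cover_fun f = \sum_(p <- s) ((f : free_pre) p : S) *: cover_gen p.
Proof.
move=> us hs; rewrite /cover_fun; case: cid => t /= ht; apply: sum_supp => //.
- exact: undup_uniq.
- by move=> p; rewrite mem_undup => /ht ->; rewrite scale0r.
by move=> p /hs ->; rewrite scale0r.
Qed.

Fact cover_linear : linear cover_fun.
Proof.
move=> a f g.
have [s hs] := elimT (fin_suppP (f : free_pre)) (valP (f : free_pre)).
have [t ht] := elimT (fin_suppP (g : free_pre)) (valP (g : free_pre)).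
have us : uniq (undup (s ++ t)) by apply: undup_uniq.
have hs' : supp_in (f : free_pre) (undup (s ++ t)).
  by move=> p; rewrite mem_undup mem_cat negb_or => /andP[/hs].
have ht' : supp_in (g : free_pre) (undup (s ++ t)).
  by move=> p; rewrite mem_undup mem_cat negb_or => /andP[_ /ht].
rewrite !(@cover_funE _ (undup (s ++ t))) //.
  rewrite scaler_sumr -big_split; apply: eq_bigr => p _ /=.
  by rewrite scalerA -scalerDl.
by move=> p hp; rewrite freeD freeZ hs' // ht' // mulr0 addr0.
Qed.

Definition cover : {linear free_mod -> V} := mk_linear cover_linear.

Lemma cover_deg : deg_preserving cover.
Proof.
move=> j f hf; have [s hs] := elimT (fin_suppP (f : free_pre)) (valP (f : free_pre)).
rewrite /= (cover_funE (undup_uniq s) (supp_in_undup hs)); apply: (gr_sum (gm_grading V)).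
move=> p _; rewrite /cover_gen; case: asboolP => [[_ hp]|_].
  by rewrite -(subrK p.1 j); apply: gm_scale => //; apply: hf.
by rewrite scaler0; apply: (grading0 (gm_grading V)).
Qed.

Lemma cover_im : submod N -> homog N -> cover @` setT = N.
Proof.
move=> sN hN; apply/seteqP; split => [_ [f _ <-]|x hx].
  apply: submod_sum => // p _; apply: submodZ => //.
  by rewrite /cover_gen; case: asboolP => [[]//|_]; apply: submod0.
have [s ->] := mcomp_sum x.
have sI : submod (cover @` setT) by apply: submod_im.
apply: submod_sum => // i _; exists (free_gen (i, mcomp i x)) => //.
rewrite /= (@cover_funE _ [:: (i, mcomp i x)]) //; last first.
  by move=> q; rewrite inE /= => /negbTE ->.
rewrite big_seq1 /= eqxx scale1r /cover_gen; case: asboolP => // h.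
by case: h; split; [apply: hN|apply: mcompP].
Qed.

End FreeCover.

Section ResolutionExists.
Variables (k : fieldType) (S : stdGradedAlg k) (M : grMod S) (N : set M).
Hypotheses (sN : submod N) (hN : homog N).

(** Each stage carries its ambient module, since the next syzygy lives in the free module just
    built. Stage 0 is [N] in [M], so term [n] of the resolution is stage [n.+1]. *)
Fixpoint syz (n : nat) : {V : grMod S & set V} :=
  match n with
  | 0 => existT _ M N
  | n.+1 => existT (fun V : grMod S => set V) (free_mod (projT1 (syz n)))
              [set x | cover (projT2 (syz n)) x = 0]
  end.

Lemma syz_submod n : submod (projT2 (syz n)) /\ homog (projT2 (syz n)).
Proof.
case: n => [//|n]; split; first exact: (submod_preim _ (@submod_set0 _ _)).
by apply: (homog_preim (@cover_deg _ _ _ _) (@homog_set0 _ _ _)).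
Qed.

Definition syz_diff n : {linear projT1 (syz n.+2) -> projT1 (syz n.+1)} :=
  cover (projT2 (syz n.+1)).

Lemma syz_exact n (x : projT1 (syz n.+1)) :
  projT2 (syz n.+1) x <-> exists y, x = syz_diff n y.
Proof.
have [h1 h2] := syz_submod n.+1; rewrite -(cover_im h1 h2); split.
  by move=> [y _ <-]; exists y.
by move=> [y ->]; exists y.
Qed.

Lemma syz_diff_diff n x : syz_diff n (syz_diff n.+1 x) = 0.
Proof. exact: ((@syz_exact n.+1 (syz_diff n.+1 x)).2 (ex_intro _ x erefl)). Qed.

Definition syz_cx : grComplex S :=
  @GrComplex k S (fun n => projT1 (syz n.+1)) syz_diff (fun n => @cover_deg _ _ _ _)
    syz_diff_diff.

Lemma free_resolution_exists : exists (F : grComplex S) (eps : {linear F 0%N -> M}),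
  free_resolution (sq_sub N) eps.
Proof.
exists syz_cx, (cover N : {linear syz_cx 0%N -> M}); split.
- by move=> n; apply: free_mod_free.
- exact: cover_deg.
- case=> // n _ x [_ /= hx].
  have [z hz] := (@syz_exact n.+1 x).1 hx.
  by exists 0, z; split => //; rewrite add0r.
split.
- move=> x _; suff : (cover N @` setT) (cover N x) by rewrite cover_im.
  by exists x.
- move=> _ [y [z [/= -> _ ->]]]; rewrite add0r.
  exact: ((@syz_exact 0 (syz_diff 0 z)).2 (ex_intro _ z erefl)).
- move=> x _ /= hx; have [z hz] := (@syz_exact 0 x).1 hx.
  by exists 0, z; split => //; rewrite add0r.
move=> y hy; have : (cover N @` setT) y by rewrite cover_im.
move=> [x _ <-].
by exists x => //; rewrite subrr.
Qed.

End ResolutionExists.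

(** * Strands and the linear part *)

Section LinearPart.
Variables (k : fieldType) (S : stdGradedAlg k) (M : grMod S) (hM : fin_gen M).
Variables (F : grComplex S) (eps : {linear F 0%N -> M}).
Hypotheses (hres : free_resolution (sq_sub setT) eps) (hmin : minimal F).
Implicit Types (n m : nat) (i d e : int).

Let heps : deg_preserving eps. Proof. by case: hres. Qed.
Let ker n : set (F n) := @aug_ker _ _ _ _ eps n.
Arguments ker : clear implicits.

Definition strand_sub d n : set (F n) := gen_le (d + n%:Z).
Arguments strand_sub : clear implicits.

(** The property [E d n] of the overview. *)
Definition strand_exact d n : Prop := forall x, strand_sub d n x -> ker n x ->
  exists2 z, strand_sub d n.+1 z & x = diff F n z.

(** The elements that become cycles modulo F_<=d-1. At position 0 the augmentation replaces the zero
    map used in [homology]. *)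
Definition strand_ker d n : set (F n) :=
  match n return set (F n) with
  | 0 => [set x | gen_le (d - 1) (eps x)]
  | m.+1 => [set x | strand_sub (d - 1) m (diff F m x)]
  end.
Arguments strand_ker : clear implicits.

Definition lin_exact d n : Prop := forall x, strand_sub d n x -> strand_ker d n x ->
  exists y z, [/\ strand_sub (d - 1) n y, strand_sub d n.+1 z & x = y + diff F n z].

(** Minimality lowers the generating degree by one, which matches the shift in [d + n%:Z]. *)
Lemma diff_strand d n x : strand_sub d n.+1 x -> strand_sub d n (diff F n x).
Proof.
apply: (gen_le_sub (submod_preim (diff F n) (gen_le_submod _ _))) => i y hi hy /=.
apply: (@gen_le_mono _ _ _ (i - 1)); first lia.
apply: mmul_gen_le; first exact: diff_deg.
by rewrite -max_ideal_mulE; apply: hmin.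
Qed.

Lemma eps_strand d : @gen_le k S M d = eps @` strand_sub d 0.
Proof.
rewrite /strand_sub addr0; apply/seteqP; split => [x|_ [x hx <-]]; last exact: lin_gen_le.
apply: (gen_le_sub (submod_im eps (gen_le_submod _ _))) => i y hi hy.
have : setT y by []; rewrite (res_cover hres) => -[z _ hz].
exists (mcomp i z); first by apply: gen_le_gen hi (mcompP _ _).
by rewrite -(mcomp_lin heps) hz mcomp_id.
Qed.

Lemma strand_sub_mono d n : strand_sub (d - 1) n `<=` strand_sub d n.
Proof. by apply: gen_le_mono; lia. Qed.

Lemma ker_strand_ker d n : ker n `<=` strand_ker d n.
Proof. by case: n => [|n] x /= ->; apply: submod0. Qed.

(** Corrects a cycle of the quotient to a cycle of [F] by exactness of F_<=d-1 one position lower.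
    At [n = 0] that condition is empty, and surjectivity onto M_<=d-1 is used instead. *)
Lemma strand_ker_lift d n x : (forall m, n = m.+1 -> strand_exact (d - 1) m) ->
  strand_ker d n x -> exists2 y, strand_sub (d - 1) n y & ker n (x - y).
Proof.
case: n x => [|n] x hE hx.
  move: hx; rewrite /= (eps_strand (d - 1)) => -[y hy hyx].
  by exists y => //; rewrite /ker /= linearB hyx subrr.
have [|z hz hxz] := hE n erefl (diff F n x) hx.
  by apply/(res_exact hres); exists x.
by exists z => //; rewrite /ker /= linearB hxz subrr.
Qed.

(** The piece H_n(F_<=d) -> H_n(F_<d>) -> H_(n-1)(F_<=d-1) of the long exact sequence, for augmented
    complexes. *)
Lemma lin_exact_of_strand d n : (forall m, n = m.+1 -> strand_exact (d - 1) m) ->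
  strand_exact d n -> lin_exact d n.
Proof.
move=> h1 h2 x hx hkx; have [y hy hxy] := strand_ker_lift h1 hkx.
have [|z hz e] := h2 (x - y) _ hxy.
  by apply: submodB => //; apply: strand_sub_mono.
by exists y, z; split => //; rewrite -e addrC subrK.
Qed.

(** The piece H_n(F_<=d-1) -> H_n(F_<=d) -> H_n(F_<d>) of the same sequence. *)
Lemma strand_exact_step d n : strand_exact (d - 1) n -> lin_exact d n -> strand_exact d n.
Proof.
move=> h1 h2 x hx hkx; have [y [z [hy hz exyz]]] := h2 x hx (ker_strand_ker d hkx).
have [|w hw ew] := h1 y hy.
  have -> : y = x - diff F n z by rewrite exyz addrK.
  apply: submodB => //; first exact: aug_ker_submod.
  by apply/(res_exact hres); exists z.
exists (w + z); last by rewrite linearD -ew.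
by apply: submodD => //; apply: strand_sub_mono.
Qed.

(** As [S] is nonnegatively graded, each [low d0] is a submodule, and finitely many generators lie
    in a common one. *)
Lemma fin_gen_bounded : exists d0, forall i (x : M), i < d0 -> gm_deg i x -> x = 0.
Proof.
pose low d0 := [set x : M | forall i, i < d0 -> mcomp i x = 0].
have slow d0 : submod (low d0).
  split=> [i _|a x y hx hy i hi]; first exact: mcomp0.
  rewrite mcompD hy // addr0; have [s hs] := mcomp_sum x.
  rewrite hs scaler_sumr mcomp_big big1 // => l _.
  rewrite (mcomp_scaler _ _ (mcompP l x)).
  have [/hx ->|ld] := ltP l d0; first by rewrite scaler0.
  by rewrite scomp_neg ?scale0r //; lia.
have [n [v hv]] := hM.
have hb (t : 'I_n) : exists l, low l (v t).
  have [s us [hs _]] := comp_sum (gm_grading M) (v t).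
  have [m hm] := int_seq_bound s; exists m => i hi; apply: hs.
  by apply/negP => /hm; lia.
have [b hb'] := choice hb.
have [d0 hd0] := int_seq_bound [seq b t | t <- enum 'I_n].
exists d0 => i x hi hx; rewrite -(mcomp_id hx).
have : span (range v) x by rewrite hv.
move=> /(span_sub (slow d0)); apply => // _ [t _ <-] j hj.
apply: hb'; apply: lt_le_trans hj (hd0 _ _).
by apply: map_f; rewrite mem_enum.
Qed.

(** A basis element of too low degree would be a cycle, hence a boundary, hence in m F_n by
    minimality, against [be_not_mmul]. *)
Lemma res_bounded d0 : (forall i (x : M), i < d0 -> gm_deg i x -> x = 0) ->
  forall n i (x : F n), i < d0 + n%:Z -> gm_deg i x -> x = 0.
Proof.
move=> h0; have main n : (forall i (x : F n), i < d0 + n%:Z -> gm_deg i x -> ker n x) ->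
    forall i (x : F n), i < d0 + n%:Z -> gm_deg i x -> x = 0.
  move=> hk i x hi hx; pose B := res_basis hres n.
  have [s _ [_ ->]] := bco_sum B x; rewrite big1 // => b _.
  have [ib|bi] := ltP i (bd b).
    have -> : bco b x = 0 :> S by apply: (@sga_neg _ _ (i - bd b)); [lia|apply: bco_deg].
    by rewrite scale0r.
  case: (@be_not_mmul k S _ B b).
  have [|z ->] := (res_exact hres (be b)).1; last by rewrite -max_ideal_mulE; apply: hmin.
  by apply: hk (be_deg b); lia.
elim=> [|n IH]; apply: main => i x hi hx.
  by apply: (h0 i); [lia|apply: heps].
(* By minimality [diff F n x] is generated in degrees at most [i - 1 < d0 + n], where [F n] vanishes
   by [IH]. *)
have hz : gen_le (i - 1) (diff F n x).
  apply: mmul_gen_le; first exact: diff_deg.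
  by rewrite -max_ideal_mulE; apply: hmin.
have : [set 0] (diff F n x); last by [].
apply: (gen_le_sub _ _ hz) => // j y hj hy; apply: IH hy; lia.
Qed.

(** Upward induction on [d] from the bound [d0], below which the strands are zero. *)
Lemma strand_exact_lin n :
  (forall d, lin_exact d n) -> forall d, strand_exact d n.
Proof.
move=> hL; have [d0 hd0] := fin_gen_bounded.
have h (t : nat) d : d < d0 + t%:Z -> strand_exact d n.
  elim: t d => [|t IH] d hd; last by apply: strand_exact_step => //; apply: IH; lia.
  move=> x hx _; exists 0; first exact: submod0.
  rewrite linear0; have : [set 0] x; last by [].
  apply: (gen_le_sub _ _ hx) => // j y hj hy.
  by apply: (res_bounded hd0 _ hy); lia.
by move=> d; apply: (h (absz (d - d0 + 1))); lia.
Qed.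

Lemma homology_linP n : sq_zero (homology_lin F n.+1) <-> forall d, lin_exact d n.+1.
Proof.
split=> h.
  move=> d x hx hkx.
  have [] := h (fun d' => if d' == d then x else 0); last first.
    move=> y [z [[_ hy] [_ hz]]] /(congr1 (fun f => f d)) /=.
    rewrite eqxx => ->; exists (y d), (z d); split => //; [exact: hy|exact: hz].
  split; split => [|d'] /=.
  - by exists [:: d] => d'; rewrite inE => /negbTE ->.
  - by case: eqP => [->|_] //; apply: submod0.
  - by exists [:: d] => d'; rewrite inE /= => /negbTE ->; rewrite linear0.
  by case: eqP => [->|_] //; rewrite ?linear0; apply: submod0.
move=> f [[[s hs] hf] [_ hdf]].
(* The pair is forced to be zero where [f d = 0], so that the chosen families keep finite
   support. *)
have hyz d : exists p : F n.+1 * F n.+2,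
  [/\ strand_sub (d - 1) n.+1 p.1, strand_sub d n.+2 p.2, f d = p.1 + diff F n.+1 p.2 &
    f d = 0 -> p = (0, 0)].
  have [fd|fd] := pselect (f d = 0).
    by exists (0, 0); split; rewrite /= ?linear0 ?addr0 //; apply: submod0.
  have [y [z [hy hz e]]] := h d (f d) (hf d) (hdf d).
  by exists (y, z); split.
have [p hp] := choice hyz.
exists (fun d => (p d).1), (fun d => (p d).2); split.
- split; last by move=> d; case: (hp d).
  by exists s => d /hs fd; case: (hp d) => _ _ _ ->.
- split; last by move=> d; case: (hp d).
  by exists s => d /hs fd; case: (hp d) => _ _ _ ->.
by apply/funext => d; case: (hp d).
Qed.

(** Injectivity of the natural map is [lin_exact d 0] for all [d]; its surjectivity comes from
    [eps_strand]. *)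
Lemma lin_gr_isoP : lin_gr_iso eps <-> forall d, lin_exact d 0.
Proof.
split=> h.
  move=> d x hx hkx; case: h => _ _ h _.
  have [] := h (fun d' => if d' == d then x else 0).
  - split=> [|d'] /=; first by exists [:: d] => d'; rewrite inE => /negbTE ->.
    by case: eqP => [->|_] //; apply: submod0.
  - split=> [|d'] /=.
      by exists [:: d] => d'; rewrite inE /= => /negbTE ->; rewrite linear0.
    by case: eqP => [->|_] //; rewrite linear0; apply: submod0.
  move=> y [z [[_ hy] [_ hz]]] /(congr1 (fun f => f d)) /=.
  rewrite eqxx => ->; exists (y d), (z d); split => //; [exact: hy|exact: hz].
split.
- move=> f [[s hs] hf]; split => /=; first by exists s => d /hs ->; rewrite linear0.
  by move=> d; rewrite eps_strand; exists (f d) => //; apply: hf.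
- move=> _ [y [z [[[s hs] hy] _ ->]]].
  have e d : eps (y d + diff F 0 (z d)) = eps (y d).
    by rewrite linearD ((res_exact hres _).2 (ex_intro _ (z d) erefl)) addr0.
  split=> [|d]; first by exists s => d /hs yd; rewrite /= [X in eps X]/= e yd linear0.
  by rewrite /= e eps_strand; exists (y d) => //; apply: hy.
- move=> f [[s hs] hf] [_ hdf].
  have hyz d : exists p : F 0%N * F 1%N,
    [/\ strand_sub (d - 1) 0 p.1, strand_sub d 1 p.2, f d = p.1 + diff F 0 p.2 &
      f d = 0 -> p = (0, 0)].
    have [fd|fd] := pselect (f d = 0).
      by exists (0, 0); split; rewrite /= ?linear0 ?addr0 //; apply: submod0.
    have [y [z [hy hz e]]] := h d (f d) (hf d) (hdf d).
    by exists (y, z); split.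
  have [p hp] := choice hyz.
  exists (fun d => (p d).1), (fun d => (p d).2); split.
  + split; last by move=> d; case: (hp d).
    by exists s => d /hs fd; case: (hp d) => _ _ _ ->.
  + split; last by move=> d; case: (hp d).
    by exists s => d /hs fd; case: (hp d) => _ _ _ ->.
  by apply/funext => d; case: (hp d).
move=> g [[s hs] hg].
have hf d : exists x : F 0%N, [/\ strand_sub d 0 x, g d = eps x & g d = 0 -> x = 0].
  have [gd|gd] := pselect (g d = 0).
    by exists 0; split; rewrite ?linear0 //; apply: submod0.
  by have := hg d; rewrite /= eps_strand => -[x hx e]; exists x.
have [f hf'] := choice hf; exists f.
  split; last by move=> d; case: (hf' d).
  by exists s => d /hs gd; case: (hf' d) => _ _ ->.
have e d : (g - (eps \o f)) d = 0 by case: (hf' d) => _ e _; apply/eqP; rewrite subr_eq0 e.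
by split=> [|d]; [exists [::] => d _|]; rewrite e //; apply: submod0.
Qed.

(** * Exact strands, vanishing of Tor and componentwise linearity *)

Section Koszul.
Variables (C : grComplex S) (aug : {linear C 0%N -> regMod S}).
Hypothesis hC : free_resolution (residue_field S) aug.
Hypothesis hgen : forall n : nat, @gen_deg k S (C n) n%:Z = setT.

Let K d n := strand_sub d n `&` ker n.
Arguments K : clear implicits.

Lemma strand_exact_im d n : strand_exact d n -> K d n = diff F n @` strand_sub d n.+1.
Proof.
move=> h; apply/seteqP; split => [x [h1 h2]|_ [x hx <-]].
  by have [z hz ->] := h x h1 h2; exists z.
by split; [apply: diff_strand|apply/(res_exact hres); exists x].
Qed.

Lemma strand_chain d n e : (forall m, (m < n)%N -> strand_exact d m) ->
  tor_zero C (@gen_le k S M d) n e <->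
  (forall x, gm_deg (e + n%:Z + 1) x -> K d n x -> mmul (strand_sub d n) x ->
    mmul (K d n) x).
Proof.
move=> h; apply: (tor_zero_chain heps hC hgen (B := res_basis hres)
  (G := strand_sub d)).
- by move=> m; apply: free_span_gen_le.
- exact: eps_strand.
by move=> m /h /strand_exact_im.
Qed.

Lemma strand_exact_tor d r : (forall n, (n < r)%N -> strand_exact d n) <->
  (forall n e, (n < r)%N -> d < e -> tor_zero C (@gen_le k S M d) n e).
Proof.
split=> h.
  move=> n e nr de; apply/strand_chain => [m mn|x hx [h1 h2] _].
    by apply: h; apply: ltn_trans nr.
  have [z hz exz] := h n nr x h1 h2.
  have hz' : strand_sub d n.+1 (mcomp (e + n%:Z + 1) z) by apply: gen_le_hom.
  rewrite -(mcomp_id hx) exz (mcomp_lin (@diff_deg _ _ F n)).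
  (* As [d < e], the preimage has degree above the generators of its strand, so it lies in m times
     the strand and its image in m K. *)
  have := gen_le_above _ (mcompP _ z) hz' => /(_ ltac:(lia)).
  apply: lin_mmul => y hy; rewrite (strand_exact_im (h n nr)); by exists y.
elim/ltn_ind=> n IH nr; have hE m : (m < n)%N -> strand_exact d m.
  by move=> mn; apply: IH => //; apply: ltn_trans nr.
pose D := diff F n @` strand_sub d n.+1.
have sD : submod D by apply: submod_im.
have hK : homog (K d n) by apply: homogI; [apply: gen_le_hom|apply: (aug_ker_homog heps)].
(* [t] bounds the excess of the degree over [d + n + 1], the top generating degree of the next
   strand. At excess 0 any homogeneous preimage already lies in that strand. *)
suff main (t : nat) i x : i <= d + n%:Z + 1 + t%:Z -> gm_deg i x -> K d n x -> D x.
  move=> x h1 h2; suff [z hz e] : D x by exists z.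
  have hD (i : int) : D (mcomp i x).
    by apply: (main (absz (i - (d + n%:Z + 1))%R) i); [lia|apply: mcompP|apply: hK].
  by have [s ->] := mcomp_sum x; apply: submod_sum => // i _.
elim: t i x => [|t IHt] i x hi hx hKx.
  have [z hz ->] := res_comp hres hx hKx.2.
  by exists z => //; apply: gen_le_gen hz; lia.
have [lt|ge] := leP i (d + n%:Z + 1 + t%:Z); first exact: IHt lt hx hKx.
(* In higher degree [x] lies in m F_<=d, so Tor vanishing with [e = i - n - 1] puts it in m K; it
   then comes from elements of K of smaller degree, covered by [IHt]. *)
rewrite -(mcomp_id hx); apply: (mmul_deg hK sD) => [v j ji hv hj|].
  by apply: IHt hj hv; lia.
apply: ((strand_chain (i - n%:Z - 1) hE).1 (h n _ nr _)) => //; first lia.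
  by rewrite (_ : _ + 1 = i) //; lia.
by apply: (gen_le_above _ hx hKx.1); lia.
Qed.

(** The first [r + 1] steps are Tor_0, which is concentrated in degree [d] by generation, and
    Tor_(n+1) for [n < r]. Below the linear degree M_<d> has no elements, and above it
    [tor_zero_gen_deg] passes to M_<=d. *)
Lemma componentwise_linearP r : componentwise_linear M r.+1 <->
  (forall d n e, (n < r)%N -> d < e -> tor_zero C (@gen_le k S M d) n e).
Proof.
split=> h.
  move=> d n e nr de; apply/tor_zero_gen_deg => //.
  have [_ hb] := h d; have := betti_tor hC hgen (hb n.+1 (e + n.+1%:Z) _ _).
  by rewrite addrK; apply; rewrite ?ltnS //; apply/eqP; lia.
move=> d; split.
  apply/seteqP; split; first by apply: span_sub => // x [].
  by apply: span_mono => x hx; split => //; apply: span_gen.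
have sN : submod (@gen_deg k S M d) by [].
have hN : homog (@gen_deg k S M d) by apply: homog_span => v hv; exists d.
have [G [g hg]] := free_resolution_exists sN hN.
move=> [|n] j nr hj; exists G, g; split => //.
  apply: (homology_tensor0 hg) => x hx hdx.
  have [lt|gt|e] := ltgtP j d.
  - by rewrite (gen_deg_low lt hx hdx); apply: submod0.
  - rewrite -(mcomp_id hx); apply: (span_deg _ _ _ hdx) => // [v hv|v i a hv hi ha].
      by exists d.
    have [->|v0] := eqVneq v 0; first by rewrite scaler0; apply: submod0.
    by apply: mmul_gen ha _; [rewrite (gm_deg_uniq hi hv v0); lia|apply: span_gen].
  by move: hj; rewrite e add0r eqxx.
apply/(homology_tensor_tor hC hgen n j hg).
have [lt|gt|e] := ltgtP (j - n.+1%:Z) d.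
- exact: tor_zero_low.
- by apply/tor_zero_gen_deg => //; apply: h.
by case/eqP: hj; lia.
Qed.

End Koszul.

End LinearPart.

Theorem theorem6p1 (k : fieldType) (S : stdGradedAlg k) (hS : koszul S)
    (M : grMod S) (hM : fin_gen M)
    (F : grComplex S) (eps : {linear F 0%N -> M})
    (hres : free_resolution (sq_sub setT) eps) (hmin : minimal F)
    (r : nat) (hr : (0 < r)%N) :
  componentwise_linear M r.+1 <->
  (forall n : nat, (0 < n < r)%N -> sq_zero (homology_lin F n)) /\
  lin_gr_iso eps.
Proof.
have [C [aug [hC hgen]]] := hS.
rewrite (componentwise_linearP M hC hgen).
have hE : (forall d n e, (n < r)%N -> d < e -> tor_zero C (@gen_le k S M d) n e) <->
    (forall d n, (n < r)%N -> strand_exact eps d n).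
  have st d := strand_exact_tor hres hmin hC hgen d r.
  by split=> h d; [apply: (st d).2 (h d)|apply: (st d).1 (h d)].
rewrite hE; split=> [h|[h1 h2] d n nr].
  (* Exactness of the linear strand at [n] uses exactness of F_<=d at [n] and of F_<=d-1 at [n - 1],
     both positions being below [r]. *)
  have hL d n : (n < r)%N -> lin_exact eps d n.
    move=> nr; apply: (lin_exact_of_strand hres) => [m nm|]; last exact: h.
    by apply: h; rewrite -ltnS -nm ltnS ltnW.
  split; last by apply/(lin_gr_isoP hres) => d; apply: hL.
  by case=> // n /andP[_ nr]; apply/(homology_linP eps) => d; apply: hL.
(* Position 0 is supplied by the natural map, the positive positions by the vanishing of H_n(lin
   F). *)
apply: (strand_exact_lin hM hres hmin); case: n nr => [|n] nr.
  exact/(lin_gr_isoP hres).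
by apply/homology_linP; apply: h1.
Qed.
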